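(* Let $\mathfrak g=\mathfrak{sp}_4(\mathbb C)$, $f=f_{subreg}$, and let either $k=-3+p/3$ with $p\ge3$, $\gcd(p,3)=1$ (principal admissible case), or $k=-3+p/4$ with $p\ge4$, $\gcd(p,2)=1$ (coprincipal admissible case). Let $\Phi$ be the automorphism of $\mathcal W^k(\mathfrak g,f)$ with $\Phi(L)=L$, $\Phi(J)=-J$, $\Phi(G^\pm)=G^\mp$, and for a module $M$ let $\Phi(M)$ be $M$ with action twisted by $\Phi$. Then $\Phi$ induces an action on the set of (isomorphism classes of) simple $\mathcal W_k(\mathfrak g,f)$-modules, given by $$\Phi\big(L(\xi^{(s)}_{i,j},\chi^{(s)}_{i,j})\big)\simeq L\big(-(\xi^{(s)}_{i,j}+i-1),\chi^{(s)}_{i,j}\big).$$ Moreover $\Phi$ is an involution ($\Phi^2=\mathrm{Id}$), and it fixes each simple module of the first form ($s=1$, respectively $s=1'$). If $k$ is principal admissible, $\Phi$ induces a one-to-one correspondence between the modules of the second form ($s=2$) and those of the third form ($s=3$). If $k$ is coprincipal admissible, $\Phi$ induces an action on the set of simple modules of the second form ($s=2'$).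
   Context: **The $\mathcal W$-algebra.** $\mathcal W^k(\mathfrak g,f)$, $\mathfrak g=\mathfrak{sp}_4$, $f=f_{subreg}$ a subregular nilpotent, $k\neq-3$, is the universal affine $\mathcal W$-algebra (quantized Drinfeld–Sokolov reduction of the universal affine vertex algebra $V^k(\mathfrak g)$). It is the conformal vertex algebra strongly generated (with a PBW basis of ordered monomials in negative modes applied to the vacuum) by fields $J=\sum J_nz^{-n-1}$, $L=\sum L_nz^{-n-2}$, $G^\pm=\sum G^\pm_nz^{-n-2}$, where $L$ is the conformal field of central charge $c_k=-\frac{2(9+16k+6k^2)}{3+k}$, $J$ and $G^\pm$ are primary of conformal weights $1$ and $2$, and $J(z)J(w)\sim\frac{2+k}{(z-w)^2}$, $J(z)G^\pm(w)\sim\pm\frac{G^\pm(w)}{z-w}$, $G^\pm(z)G^\pm(w)\sim0$, $G^+(z)G^-(w)\sim-\frac{3(1+k)(2+k)^2}{(z-w)^4}-\frac{3(1+k)(2+k)}{(z-w)^3}J+\frac{1}{(z-w)^2}\big((2+k)(3+k)L-(3+2k):J^2:-\frac{3(1+k)(2+k)}2\partial J\big)+\frac1{z-w}\big((3+k):LJ:+\frac{(3+k)(2+k)}2\partial L-:J^3:-(3+2k):J\partial J:-\frac{5+4k+k^2}2\partial^2J\big)$ (fields on the right at $w$). $\mathcal W_k(\mathfrak g,f)$ is its unique simple graded quotient. **Modules $L(\xi,\chi)$.** $L(\xi,\chi)$ is the (unique up to isomorphism) irreducible $\mathcal W^k(\mathfrak g,f)$-module generated by a nonzero vector $v$ with $J_0v=\xi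 v$, $L_0v=\chi v$, $J_nv=L_nv=G^+_nv=0$ for $n>0$, $G^-_nv=0$ for $n\ge0$. **Simple $\mathcal W_k$-modules.** In the principal case they are $L(\xi^{(s)}_{i,j},\chi^{(s)}_{i,j})$, $s\in\{1,2,3\}$, $1\le i\le p-2$, $1\le j\le p-i-1$. In the coprincipal case they are $L(\xi^{(1')}_{i,j},\chi^{(1')}_{i,j})$, $1\le i\le p-3$, $1\le j\le(p-i-1)/2$, and $L(\xi^{(2')}_{i,j},\chi^{(2')}_{i,j})$, $1\le i\le p-3$, $1\le j\le p-2i-1$. Modules with $s=1,1'$ / $s=2,2'$ / $s=3$ are of the first / second / third form. Here $\xi^{(1)}_{i,j}=\xi^{(1')}_{i,j}=\frac{1-i}2$, $\ \chi^{(1)}_{i,j}=\chi^{(1')}_{i,j}=\frac{13-6i+i^2-12j+2ij+2j^2+6k-2ik-4jk}{4(3+k)}$; $\xi^{(2)}_{i,j}=\xi^{(2')}_{i,j}=\frac{7-2i-j+2k}2$, $\ \chi^{(2)}_{i,j}=\chi^{(2')}_{i,j}=\frac{31-12i+2i^2-12j+2ij+j^2+18k-4ik-4jk+2k^2}{4(3+k)}$; $\xi^{(3)}_{i,j}=\frac{4-i-j+k}2$, $\ \chi^{(3)}_{i,j}=\frac{4+i^2-6j+j^2-2jk-k^2}{4(3+k)}$. The automorphism $\Phi$ is the one induced by the nontrivial element of the component group ($\simeq\mathbb Z/2\mathbb Z$) of the subregular nilpotent orbit. *)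

(* Defs.v *)
From HB Require Import structures.
From mathcomp Require Import all_boot all_order all_algebra.
From mathcomp Require Import reals.
From mathcomp Require Import complex.

Set Implicit Arguments.
Unset Strict Implicit.
Unset Printing Implicit Defensive.

Import GRing.Theory Num.Theory.
Local Open Scope ring_scope.

(* [nprod a n b] is the n-th product a_(n) b, i.e. the coefficient of
   z^(-n-1) in Y(a, z) b.  All vertex algebras here are purely even. *)

(* The binomial coefficient m (m-1) ... (m-j+1) / j! for an integer m. *)
Definition binz (K : numFieldType) (m : int) (j : nat) : K :=
  (\prod_(i < j) (m - i%:Z)%:~R) / (j`!)%:R.

(* The Borcherds (Jacobi) identity
     sum_j C(p,j) (a_(r+j) b)_(p+q-j) x
       = sum_j (-1)^j C(r,j)
           (a_(p+r-j) b_(q+j) x - (-1)^r b_(q+r-j) a_(p+j) x).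
   The sums over j >= 0 have finitely many nonzero terms; they are cut at any
   N beyond which all the terms vanish. *)
Definition borcherds (K : numFieldType) (V M : lmodType K)
    (prod : V -> int -> V -> V) (act : V -> int -> M -> M) : Prop :=
  forall (a b : V) (x : M) (p q r : int) (N : nat),
    (forall j : nat, (N <= j)%N ->
       [/\ prod a (r + j%:Z) b = 0,
           act b (q + j%:Z) x = 0 &
           act a (p + j%:Z) x = 0]) ->
    \sum_(j < N) binz K p j *:
        act (prod a (r + j%:Z) b) (p + q - j%:Z) x
    = \sum_(j < N) ((-1) ^+ j * binz K r j) *:
        (act a (p + r - j%:Z) (act b (q + j%:Z) x)
         - (-1) ^ r *: act b (q + r - j%:Z) (act a (p + j%:Z) x)).

Record vertexAlgebra (K : numFieldType) := VertexAlgebra {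
  va_sort :> lmodType K;
  vac : va_sort;
  nprod : va_sort -> int -> va_sort -> va_sort;
  nprod_linearl : forall (n : int) (b : va_sort), linear (fun a => nprod a n b);
  nprod_linearr : forall (a : va_sort) (n : int), linear (nprod a n);
  nprod_trunc : forall a b : va_sort,
    exists N : nat, forall j : nat, (N <= j)%N -> nprod a j%:Z b = 0;
  nprod_vacl : forall (n : int) (b : va_sort),
    nprod vac n b = if n == -1 then b else 0;
  nprod_vacr : forall a : va_sort, nprod a (-1) vac = a;
  nprod_vacr0 : forall (a : va_sort) (n : nat), nprod a n%:Z vac = 0;
  nprod_borcherds : borcherds nprod nprod
}.

Record vmodule (K : numFieldType) (V : vertexAlgebra K) := VModule {
  vm_sort :> lmodType K;
  act : V -> int -> vm_sort -> vm_sort;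
  act_linearl : forall (n : int) (x : vm_sort), linear (fun a => act a n x);
  act_linearr : forall (a : V) (n : int), linear (act a n);
  act_trunc : forall (a : V) (x : vm_sort),
    exists N : nat, forall j : nat, (N <= j)%N -> act a j%:Z x = 0;
  act_vac : forall (n : int) (x : vm_sort),
    act (vac V) n x = if n == -1 then x else 0;
  act_borcherds : borcherds (@nprod K V) act
}.

Record vhom (K : numFieldType) (V W : vertexAlgebra K) := VHom {
  vhom_fun :> V -> W;
  vhom_linear : linear vhom_fun;
  vhom_vac : vhom_fun (vac V) = vac W;
  vhom_nprod : forall (a : V) (n : int) (b : V),
    vhom_fun (nprod a n b) = nprod (vhom_fun a) n (vhom_fun b)
}.

Section Modules.
Variables (K : numFieldType) (V : vertexAlgebra K).

Definition is_submodule (M : vmodule V) (N : M -> Prop) : Prop :=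
  [/\ N 0,
      forall (c : K) (x y : M), N x -> N y -> N (c *: x + y) &
      forall (a : V) (n : int) (x : M), N x -> N (act a n x)].

Definition irreducible (M : vmodule V) : Prop :=
  (exists x : M, x != 0) /\
  forall N : M -> Prop, is_submodule N ->
    (forall x, N x -> x = 0) \/ (forall x, N x).

Definition viso (M N : vmodule V) : Prop :=
  exists f : M -> N,
    [/\ linear f, bijective f &
        forall (a : V) (n : int) (x : M), f (act a n x) = act a n (f x)].

Definition is_ideal (I : V -> Prop) : Prop :=
  [/\ I 0,
      forall (c : K) (a b : V), I a -> I b -> I (c *: a + b) &
      forall (a b : V) (n : int), I b -> I (nprod a n b) /\ I (nprod b n a)].

Definition is_simple : Prop :=
  vac V != 0 /\
  forall I : V -> Prop, is_ideal I ->
    (forall a, I a -> a = 0) \/ (forall a, I a).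

End Modules.

Section Pullback.
Variables (K : numFieldType) (V W : vertexAlgebra K).
Variables (f : vhom V W) (M : vmodule W).

Definition pb_act (a : V) (n : int) (x : M) : M := act (f a) n x.

Lemma pb_linearl (n : int) (x : M) : linear (fun a => pb_act a n x).
Proof.
by move=> c a b; rewrite /pb_act vhom_linear (act_linearl n x c (f a) (f b)).
Qed.

Lemma pb_linearr (a : V) (n : int) : linear (pb_act a n).
Proof. exact: act_linearr. Qed.

Lemma pb_trunc (a : V) (x : M) :
  exists N : nat, forall j : nat, (N <= j)%N -> pb_act a j%:Z x = 0.
Proof. exact: act_trunc. Qed.

Lemma pb_vac (n : int) (x : M) :
  pb_act (vac V) n x = if n == -1 then x else 0.
Proof. by rewrite /pb_act vhom_vac act_vac. Qed.

Lemma vhom0 : f 0 = 0.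
Proof.
have := vhom_linear f 1 0 0; rewrite !scale1r addr0 => /eqP.
by rewrite -subr_eq0 opprD addrA subrr sub0r oppr_eq0 => /eqP.
Qed.

Lemma pb_borcherds : borcherds (@nprod K V) pb_act.
Proof.
move=> a b x p q r N H; rewrite /pb_act -act_borcherds; last first.
  move=> j /H[h1 h2 h3]; split=> //.
  by rewrite -vhom_nprod h1 vhom0.
by apply: eq_bigr => j _; rewrite vhom_nprod.
Qed.

(* The W-module M regarded as a V-module through f. *)
Definition pullback : vmodule V :=
  VModule pb_linearl pb_linearr pb_trunc pb_vac pb_borcherds.

End Pullback.

Definition twist (K : numFieldType) (V : vertexAlgebra K)
  (Phi : vhom V V) (M : vmodule V) : vmodule V := pullback Phi M.

Section OPE.
Variables (K : numFieldType) (V : vertexAlgebra K).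
Implicit Types (a b : V).

Definition transl a : V := nprod a (- 2) (vac V).

Definition nord a b : V := nprod a (- 1) b.

(* a(z) b(w) ~ sum_n s_n(w) / (z-w)^(n+1): the list s starts with the
   coefficient of the simple pole. *)
Definition OPE a b (s : seq V) : Prop :=
  forall n : nat, nprod a n%:Z b = s`_n.

Definition conformal (L : V) (c : K) : Prop :=
  [/\ OPE L L [:: transl L; 2 *: L; 0; (c / 2) *: vac V],
      forall a, nprod L 0 a = transl a &
      forall a, exists s : seq V,
        a = \sum_(b <- s) b /\
        forall b, b \in s -> exists d : K, nprod L 1 b = d *: b].

Definition primary (L : V) (d : K) a : Prop := OPE L a [:: transl a; d *: a].

(* A letter (i, n) stands for the mode (X_i)_(-n-1), and a word for the
   product of its letters applied to the vacuum. *)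
Definition monomial (m : nat) (X : m.-tuple V) (w : seq ('I_m * nat)) : V :=
  foldr (fun l v => nprod (tnth X l.1) (- (l.2.+1)%:Z) v) (vac V) w.

Definition letter_le (m : nat) (l l' : 'I_m * nat) : bool :=
  (l.1 < l'.1)%N || ((l.1 == l'.1) && (l'.2 <= l.2)%N).

Definition pbw_basis (m : nat) (X : m.-tuple V) : Prop :=
  (forall v : V, exists (s : seq (seq ('I_m * nat))) (c : seq ('I_m * nat) -> K),
     all (sorted (@letter_le m)) s /\
     v = \sum_(w <- s) c w *: monomial X w) /\
  (forall (s : seq (seq ('I_m * nat))) (c : seq ('I_m * nat) -> K),
     uniq s -> all (sorted (@letter_le m)) s ->
     \sum_(w <- s) c w *: monomial X w = 0 ->
     {in s, forall w, c w = 0}).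

End OPE.

Definition central_charge (K : numFieldType) (k : K) : K :=
  - (2 * (9 + 16 * k + 6 * k ^+ 2)) / (3 + k).

Section SubregularW.
Variables (K : numFieldType) (V : vertexAlgebra K).
Variables (k : K) (J L Gp Gm : V).

Definition GpGm_pole4 : V := - (3 * (1 + k) * (2 + k) ^+ 2) *: vac V.

Definition GpGm_pole3 : V := - (3 * (1 + k) * (2 + k)) *: J.

Definition GpGm_pole2 : V :=
  ((2 + k) * (3 + k)) *: L - (3 + 2 * k) *: nord J J
  - (3 * (1 + k) * (2 + k) / 2) *: transl J.

Definition GpGm_pole1 : V :=
  (3 + k) *: nord L J + ((3 + k) * (2 + k) / 2) *: transl L
  - nord J (nord J J) - (3 + 2 * k) *: nord J (transl J)
  - ((5 + 4 * k + k ^+ 2) / 2) *: transl (transl J).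

(* V is W^k(sp_4, f_subreg) with its strong generators J, L, G^+, G^-. *)
Record is_subregular_W : Prop := IsSubregularW {
  sW_conformal : conformal L (central_charge k);
  sW_primary_J : primary L 1 J;
  sW_primary_Gp : primary L 2 Gp;
  sW_primary_Gm : primary L 2 Gm;
  sW_J_J : OPE J J [:: 0; (2 + k) *: vac V];
  sW_J_Gp : OPE J Gp [:: Gp];
  sW_J_Gm : OPE J Gm [:: - Gm];
  sW_Gp_Gp : OPE Gp Gp [::];
  sW_Gm_Gm : OPE Gm Gm [::];
  sW_Gp_Gm : OPE Gp Gm [:: GpGm_pole1; GpGm_pole2; GpGm_pole3; GpGm_pole4];
  sW_pbw : pbw_basis [tuple J; L; Gp; Gm]
}.

(* a_n for a of conformal weight d, where a(z) = sum_n a_n z^(-n-d). *)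
Definition mode (M : vmodule V) (d : int) (a : V) (n : int) (x : M) : M :=
  act a (n + d - 1) x.

Definition generates (M : vmodule V) (v : M) : Prop :=
  forall N : M -> Prop, is_submodule N -> N v -> forall x, N x.

(* M is (a model of) the irreducible module L(xi, chi). *)
Definition is_L (xi chi : K) (M : vmodule V) : Prop :=
  irreducible M /\
  exists v : M,
    [/\ v != 0, generates v,
        mode 1 J 0 v = xi *: v /\ mode 2 L 0 v = chi *: v,
        forall n : int, 0 < n ->
          [/\ mode 1 J n v = 0, mode 2 L n v = 0 & mode 2 Gp n v = 0] &
        forall n : int, 0 <= n -> mode 2 Gm n v = 0].

End SubregularW.

(* pi exhibits S as the simple quotient of V.  Ideals of a conformal vertex
   algebra are stable under L_0, hence graded, so gradedness of the kernel
   need not be required. *)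
Definition is_simple_quotient (K : numFieldType) (V S : vertexAlgebra K)
  (pi : vhom V S) : Prop := (forall y : S, exists x : V, pi x = y) /\ is_simple S.

(* The V-modules that are simple modules over the quotient S. *)
Definition simple_quotient_module (K : numFieldType) (V S : vertexAlgebra K)
    (pi : vhom V S) (M : vmodule V) : Prop :=
  irreducible M /\ exists N : vmodule S, viso M (pullback pi N).

Inductive admissible_case := Principal | Coprincipal.

Definition admissible (K : numFieldType) (c : admissible_case) (p : nat) (k : K)
    : Prop :=
  match c with
  | Principal => [/\ (3 <= p)%N, coprime p 3 & k = - 3 + p%:R / 3]
  | Coprincipal => [/\ (4 <= p)%N, coprime p 2 & k = - 3 + p%:R / 4]
  end.

Inductive module_form := First | Second | Third.

Definition xi (K : numFieldType) (k : K) (s : module_form) (i j : nat) : K :=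
  match s with
  | First => (1 - i%:R) / 2
  | Second => (7 - 2 * i%:R - j%:R + 2 * k) / 2
  | Third => (4 - i%:R - j%:R + k) / 2
  end.

Definition chi (K : numFieldType) (k : K) (s : module_form) (i j : nat) : K :=
  let x : K := i%:R in
  let y : K := j%:R in
  match s with
  | First =>
      (13 - 6 * x + x ^+ 2 - 12 * y + 2 * x * y + 2 * y ^+ 2 + 6 * k
       - 2 * x * k - 4 * y * k) / (4 * (3 + k))
  | Second =>
      (31 - 12 * x + 2 * x ^+ 2 - 12 * y + 2 * x * y + y ^+ 2 + 18 * k
       - 4 * x * k - 4 * y * k + 2 * k ^+ 2) / (4 * (3 + k))
  | Third =>
      (4 + x ^+ 2 - 6 * y + y ^+ 2 - 2 * y * k - k ^+ 2) / (4 * (3 + k))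
  end.

(* The ranges of (i, j), with the upper bounds rearranged so as to avoid
   truncated subtraction; e.g. j <= (p - i - 1) / 2 is 2 j + i + 1 <= p. *)
Definition index_range (c : admissible_case) (p : nat) (s : module_form) (i j : nat)
    : Prop :=
  [/\ (1 <= i)%N, (1 <= j)%N &
    match c, s with
    | Principal, _ => (i + 2 <= p)%N /\ (j + i + 1 <= p)%N
    | Coprincipal, First => (i + 3 <= p)%N /\ (2 * j + i + 1 <= p)%N
    | Coprincipal, Second => (i + 3 <= p)%N /\ (j + 2 * i + 1 <= p)%N
    | Coprincipal, Third => False
    end].

Definition of_form (K : numFieldType) (V : vertexAlgebra K) (k : K)
    (J L Gp Gm : V) (c : admissible_case) (p : nat) (s : module_form)
    (M : vmodule V) : Prop :=
  exists i j : nat, index_range c p s i j /\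
    is_L J L Gp Gm (xi k s i j) (chi k s i j) M.

(* A set of isomorphism classes is given by an isomorphism-invariant
   predicate on modules. *)

Section Classes.
Variables (K : numFieldType) (V : vertexAlgebra K).
Variable F : vmodule V -> vmodule V.

Definition acts_on_classes (A : vmodule V -> Prop) : Prop :=
  (forall M, A M -> A (F M)) /\
  (forall M N, A M -> A N -> viso M N -> viso (F M) (F N)).

Definition bijective_on_classes (A B : vmodule V -> Prop) : Prop :=
  [/\ forall M, A M -> B (F M),
      forall M N, A M -> A N -> (viso M N <-> viso (F M) (F N)) &
      forall N, B N -> exists M, A M /\ viso (F M) N].

End Classes.

(* Main.v *)
Require Import Defs.
From HB Require Import structures.
From mathcomp Require Import all_boot all_order all_algebra.
From mathcomp Require Import reals.
From mathcomp Require Import complex.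
From mathcomp Require Import zify ring.
From mathcomp Require boolp.

(* A lowest weight vector v is killed by the positive modes of the generators,
   hence (Borcherds identity, induction on the conformal weight) by those of all
   fields, and the zero modes preserve the space of such vectors. So the L_0-top
   of the submodule generated by v is the span of the (G^+_0)^n v. There
   [G^+_0, G^-_0] acts by s (A - s^2), where s is the eigenvalue of J_0 and
   A = (3 + k) chi + (k + 1)(k + 2) / 2. Summing, G^-_0 (G^+_0)^m v is a multiple
   of (G^+_0)^(m-1) v whose coefficient, for the weights (xi_ij, chi_ij), is
   m (m - i) times a product of two factors that cannot vanish because k + 3 and
   2 (k + 3) are not integers. Hence the top space of L(xi_ij, chi_ij) has
   dimension i and (G^+_0)^(i-1) v is the lowest weight vector of the twisted
   module, with weights (- (xi_ij + i - 1), chi_ij). Up to isomorphism the weights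
   determine the module; they match under j |-> p - i - j (second and third forms,
   principal case) and j |-> p - 2 i - j (second form, coprincipal case). *)

Set Implicit Arguments.
Unset Strict Implicit.
Unset Printing Implicit Defensive.

Import Order.TTheory GRing.Theory Num.Theory.
Local Open Scope ring_scope.

(** * Spans and eigencomponents *)

Section Span.
Variables (K : numFieldType) (M : lmodType K).

Definition subspace (N : M -> Prop) : Prop :=
  N 0 /\ forall (c : K) (x y : M), N x -> N y -> N (c *: x + y).

(** As an intersection of subspaces, the span is eliminated by choosing [N], without handling
    coefficients. *)
Definition lin_span (S : M -> Prop) (x : M) : Prop :=
  forall N, subspace N -> (forall y, S y -> N y) -> N x.

Section Closure.
Variables (N : M -> Prop) (hN : subspace N).

Lemma subspaceD x y : N x -> N y -> N (x + y).
Proof. by move=> hx hy; rewrite -[x]scale1r; apply: hN.2. Qed.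

Lemma subspaceZ c x : N x -> N (c *: x).
Proof. by move=> hx; rewrite -[_ *: _]addr0; apply: hN.2 => //; apply: hN.1. Qed.

Lemma subspaceN x : N x -> N (- x).
Proof. by move=> hx; rewrite -scaleN1r; apply: subspaceZ. Qed.

Lemma subspaceB x y : N x -> N y -> N (x - y).
Proof. by move=> hx hy; apply: subspaceD => //; apply: subspaceN. Qed.

Lemma subspace_sum (I : Type) (r : seq I) (P : pred I) (F : I -> M) :
  (forall i, P i -> N (F i)) -> N (\sum_(i <- r | P i) F i).
Proof. by move=> h; apply: big_ind => //; [apply: hN.1 | apply: subspaceD]. Qed.
End Closure.

Lemma lin_span_subspace S : subspace (lin_span S).
Proof.
split=> [N hN _|c x y hx hy N hN hS]; first exact: hN.1.
by apply: hN.2; [apply: hx | apply: hy].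
Qed.

Lemma lin_span_incl (S : M -> Prop) x : S x -> lin_span S x.
Proof. by move=> hx N _; apply. Qed.

End Span.

Lemma subspace_preim (K : numFieldType) (M M' : lmodType K) (f : M' -> M) (N : M -> Prop) :
  linear f -> subspace N -> subspace (fun x => N (f x)).
Proof.
move=> lf hN; split=> [|c x y hx hy]; last by rewrite lf; apply: hN.2.
suff -> : f 0 = 0 by case: hN.
by apply: (addrI (f 0)); rewrite -{1}[f 0]scale1r -lf scale1r !addr0.
Qed.

Section Eigen.
Variables (K : numFieldType) (M : lmodType K) (f : {linear M -> M}).

Definition eig_op (s : seq K) (x : M) : M :=
  foldr (fun mu y => f y - mu *: y) x s.

(* [x] is a sum of generalized eigenvectors for eigenvalues other than [l]. *)
Definition off_eig (l : K) (x : M) : Prop :=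
  exists2 s : seq K, l \notin s & eig_op s x = 0.

Lemma eig_op_linear s : linear (eig_op s).
Proof.
elim: s => [|mu s IH] c x y //=; rewrite IH linearP scalerBr !scalerDr !scalerA.
by rewrite [mu * c]mulrC opprD addrACA.
Qed.

Lemma eig_op0 s : eig_op s 0 = 0.
Proof. by elim: s => //= mu s ->; rewrite raddf0 scaler0 subr0. Qed.

Lemma eig_opC mu s x : eig_op s (f x - mu *: x) = f (eig_op s x) - mu *: eig_op s x.
Proof.
elim: s => //= nu s ->; rewrite !raddfB /= !linearZ /=.
rewrite !scalerN !opprK !scalerA [nu * mu]mulrC !addrA; congr (_ + _).
by rewrite addrAC.
Qed.

Lemma eig_op_cat s s' x : eig_op (s ++ s') x = eig_op s (eig_op s' x).
Proof. exact: foldr_cat. Qed.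

Lemma eig_op_comm s s' x : eig_op s (eig_op s' x) = eig_op s' (eig_op s x).
Proof. by elim: s' => //= mu s' <-; rewrite eig_opC. Qed.

Lemma off_eig_subspace l : subspace (off_eig l).
Proof.
split=> [|c x y [s hs hx] [s' hs' hy]]; first by exists [::].
exists (s ++ s'); first by rewrite mem_cat negb_or hs.
by rewrite eig_op_linear !eig_op_cat hy eig_op_comm hx !eig_op0 scaler0 addr0.
Qed.

Lemma off_eig_eigen l mu x : f x = mu *: x -> mu != l -> off_eig l x.
Proof.
by move=> hx hmu; exists [:: mu]; rewrite ?inE 1?eq_sym //= hx subrr.
Qed.

(** The product of the [f - mu] over [s] kills [y] and scales [t] by the product of the [l - mu],
    nonzero because [l] is not in [s]. *)
Lemma eig_component (N : M -> Prop) l t y :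
  subspace N -> (forall x, N x -> N (f x)) -> f t = l *: t -> off_eig l y ->
  N (t + y) -> N t.
Proof.
move=> hN fN ft [s ls sy] hty.
have: N (eig_op s (t + y)).
  elim: s {ls sy} => //= mu s IH; apply: subspaceB => //; first exact: fN.
  exact: subspaceZ.
have -> : eig_op s (t + y) = eig_op s t.
  by have := eig_op_linear s 1 t y; rewrite sy !scale1r addr0.
have [c c0 ->] : exists2 c, c != 0 & eig_op s t = c *: t.
  elim: s ls {sy} => [|mu s IH]; first by exists 1; rewrite ?oner_neq0 // scale1r.
  rewrite inE negb_or /= => /andP[hmu /IH[c c0 ->]].
  exists (l * c - mu * c); first by rewrite -mulrBl mulf_neq0 // subr_eq0.
  by rewrite linearZ /= ft scalerBl !scalerA [c * l]mulrC.
by move/(subspaceZ hN c^-1); rewrite scalerA mulVf // scale1r.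
Qed.

Lemma eig_uniq l u t y :
  f u = l *: u -> f t = l *: t -> off_eig l y -> u = t + y -> u = t.
Proof.
move=> fu ft hy e; apply/eqP; rewrite eq_sym -subr_eq0; apply/eqP.
apply: (@eig_component (fun x => x = 0) l (t - u) y) => //.
- by split=> // c x z -> ->; rewrite scaler0 addr0.
- by move=> x ->; rewrite raddf0.
- by rewrite raddfB /= ft fu scalerBr.
- by rewrite addrAC -e subrr.
Qed.

End Eigen.

(** * Generalized binomial coefficients *)

Lemma binz_nat (K : numFieldType) (m j : nat) : binz K m j = ('C(m, j))%:R.
Proof.
rewrite /binz; have f0 : (j`!%:R : K) != 0 by rewrite pnatr_eq0 -lt0n fact_gt0.
apply/(canLR (mulfK f0)); rewrite -natrM bin_ffact.
elim: j {f0} => [|j IH]; first by rewrite big_ord0.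
rewrite big_ord_recr /= IH ffactnSr natrM.
have [le_jm|lt_mj] := leqP j m; first by rewrite subzn // -pmulrn.
by rewrite ffact_small // !mul0r.
Qed.

Lemma binz0 (K : numFieldType) (m : int) : binz K m 0 = 1.
Proof. by rewrite /binz big_ord0 divr1. Qed.

(** These are the coefficients of (1 - x)^(-2); the case r = -2 of the Borcherds identity yields the
    modes of [transl a]. *)
Lemma binzN2 (K : numFieldType) (j : nat) :
  (-1) ^+ j * binz K (- 2) j = j.+1%:R.
Proof.
rewrite /binz mulrA; have f0 : (j`!%:R : K) != 0 by rewrite pnatr_eq0 -lt0n fact_gt0.
apply/(canLR (mulfK f0)); rewrite -natrM -factS.
elim: j {f0} => [|j IH]; first by rewrite big_ord0 mulr1.
rewrite big_ord_recr /= exprS factS natrM -IH.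
rewrite !intrB.
have -> : (-2)%:~R = -2%:R :> K by rewrite mulrNz.
rewrite -[j.+2]addn2 natrD -!pmulrn /=; ring.
Qed.

(** * Consequences of the Borcherds identity *)

HB.instance Definition _ (K : numFieldType) (V : vertexAlgebra K) (M : vmodule V)
  (a : V) (n : int) := GRing.isLinear.Build K M M *:%R (act a n) (act_linearr a n).

HB.instance Definition _ (K : numFieldType) (V W : vertexAlgebra K) (f : vhom V W) :=
  GRing.isLinear.Build K V W *:%R f (vhom_linear f).

HB.instance Definition _ (K : numFieldType) (V : vertexAlgebra K) (a : V) (n : int) :=
  GRing.isLinear.Build K V V *:%R (nprod a n) (nprod_linearr a n).

(** Makes the lemmas on modules apply to the products of [V] itself. *)
Definition adjoint (K : numFieldType) (V : vertexAlgebra K) : vmodule V :=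
  VModule (@nprod_linearl K V) (@nprod_linearr K V) (@nprod_trunc K V)
    (@nprod_vacl K V) (@nprod_borcherds K V).

Section Modes.
Variables (K : numFieldType) (V : vertexAlgebra K) (M : vmodule V).
Implicit Types (a b : V) (x : M) (n p q r : int).

Definition mode_at (n : int) (x : M) (a : V) : M := act a n x.

HB.instance Definition _ (n : int) (x : M) :=
  GRing.isLinear.Build K V M *:%R (mode_at n x) (act_linearl n x).

Lemma act0l n x : act (0 : V) n x = 0.
Proof. exact: (raddf0 (mode_at n x)). Qed.

Lemma actDl n x a b : act (a + b) n x = act a n x + act b n x.
Proof. exact: (raddfD (mode_at n x)). Qed.

Lemma actBl n x a b : act (a - b) n x = act a n x - act b n x.
Proof. exact: (raddfB (mode_at n x)). Qed.

Lemma actNl n x a : act (- a) n x = - act a n x.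
Proof. exact: (raddfN (mode_at n x)). Qed.

Lemma actZl n x c a : act (c *: a) n x = c *: act a n x.
Proof. exact: (linearZ_LR (mode_at n x)). Qed.

Lemma act_trunc_from a q x :
  exists N : nat, forall j : nat, (N <= j)%N -> act a (q + j%:Z) x = 0.
Proof.
have [N hN] := act_trunc a x; exists (N + `|q|)%N => j hj.
have -> : q + j%:Z = (`|(q + j%:Z)%R|%N)%:Z by lia.
by apply: hN; lia.
Qed.

Lemma nprod_trunc_from a q b :
  exists N : nat, forall j : nat, (N <= j)%N -> nprod a (q + j%:Z) b = 0.
Proof.
have [N hN] := nprod_trunc a b; exists (N + `|q|)%N => j hj.
have -> : q + j%:Z = (`|(q + j%:Z)%R|%N)%:Z by lia.
by apply: hN; lia.
Qed.

Lemma borcherds_trunc a b x p q r : exists N0 : nat, forall N : nat, (N0 <= N)%N ->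
  \sum_(j < N) binz K p j *: act (nprod a (r + j%:Z) b) (p + q - j%:Z) x
  = \sum_(j < N) ((-1) ^+ j * binz K r j) *:
      (act a (p + r - j%:Z) (act b (q + j%:Z) x)
       - (-1) ^ r *: act b (q + r - j%:Z) (act a (p + j%:Z) x)).
Proof.
have [N1 h1] := nprod_trunc_from a r b.
have [N2 h2] := act_trunc_from b q x.
have [N3 h3] := act_trunc_from a p x.
exists (N1 + N2 + N3)%N => N hN; apply: act_borcherds => j hj.
by split; [apply: h1 | apply: h2 | apply: h3]; lia.
Qed.

Lemma sum_ord_cut (W : lmodType K) (F : nat -> W) (n N : nat) :
  (n <= N)%N -> (forall j, (n <= j)%N -> F j = 0) ->
  \sum_(j < N) F j = \sum_(j < n) F j.
Proof.
move=> hN F0; rewrite -(subnKC hN) big_split_ord /= [X in _ + X]big1 ?addr0 //.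
by move=> j _; apply: F0; apply: leq_addr.
Qed.

(** Each side has its own bound and only whole terms need to vanish, so the binomial coefficients
    may do the cutting. *)
Lemma borcherds_cut a b x p q r (n1 n2 : nat) :
  (forall j : nat, (n1 <= j)%N ->
     binz K p j *: act (nprod a (r + j%:Z) b) (p + q - j%:Z) x = 0) ->
  (forall j : nat, (n2 <= j)%N ->
     ((-1) ^+ j * binz K r j) *:
       (act a (p + r - j%:Z) (act b (q + j%:Z) x)
        - (-1) ^ r *: act b (q + r - j%:Z) (act a (p + j%:Z) x)) = 0) ->
  \sum_(j < n1) binz K p j *: act (nprod a (r + j%:Z) b) (p + q - j%:Z) x
  = \sum_(j < n2) ((-1) ^+ j * binz K r j) *:
      (act a (p + r - j%:Z) (act b (q + j%:Z) x)
       - (-1) ^ r *: act b (q + r - j%:Z) (act a (p + j%:Z) x)).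
Proof.
move=> h1 h2; have [N0 h] := borcherds_trunc a b x p q r.
have l0 : (N0 <= maxn N0 (maxn n1 n2))%N by apply: leq_maxl.
have l1 : (n1 <= maxn N0 (maxn n1 n2))%N by rewrite !leq_max leqnn orbT.
have l2 : (n2 <= maxn N0 (maxn n1 n2))%N by rewrite !leq_max leqnn !orbT.
rewrite -(sum_ord_cut l1 h1) -(sum_ord_cut l2 h2); exact: h.
Qed.

(** The case r = 0: only j = 0 survives on the right, and C(m, j) cuts the left side after j = m. *)
Lemma act_comm a b x (m : nat) q :
  act a m (act b q x) - act b q (act a m x)
  = \sum_(j < m.+1) ('C(m, j))%:R *: act (nprod a j%:Z b) (m%:Z + q - j%:Z) x.
Proof.
have := @borcherds_cut a b x m q 0 m.+1 1.
rewrite big_ord1 binz0 expr0 mulr1 scale1r expr0z scale1r !addr0 => <-.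
- by apply: eq_bigr => j _; rewrite binz_nat add0r.
- by move=> j hj; rewrite binz_nat bin_small // scale0r.
- by case=> // j _; rewrite (binz_nat _ 0) bin0n mulr0 scale0r.
Qed.

Lemma act_comm0 a b x q :
  act a 0 (act b q x) = act b q (act a 0 x) + act (nprod a 0 b) q x.
Proof.
apply/eqP; rewrite addrC -subr_eq act_comm big_ord1 bin0 scale1r add0r subr0.
by [].
Qed.

Lemma act_comm1 a b x q :
  act a 1 (act b q x)
  = act b q (act a 1 x) + (act (nprod a 0 b) (1 + q) x + act (nprod a 1 b) q x).
Proof.
apply/eqP; rewrite addrC -subr_eq act_comm !big_ord_recr big_ord0 /= add0r.
by rewrite bin0 bin1 !scale1r subr0 [1 + q]addrC addrK.
Qed.

(** The case b = vac, p = 0, r = -2. Vacuum modes vanish except at index -1, so at most one term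
    survives on the right. *)
Lemma act_transl a q x : act (transl a) q x = - q%:~R *: act a (q - 1) x.
Proof.
have := @borcherds_cut a (vac V) x 0 q (- 2) 1 (1 + `|q|)%N.
rewrite big_ord1 binz0 scale1r addr0 add0r subr0 -/(transl a).
have hF j : ((-1) ^+ j * binz K (- 2) j) *:
      (act a (0 - 2 - j%:Z) (act (vac V) (q + j%:Z) x)
       - (-1) ^ (- 2) *: act (vac V) (q - 2 - j%:Z) (act a (0 + j%:Z) x))
   = (if (j%:Z == - 1 - q) || (j%:Z == q - 1) then - q%:~R *: act a (q - 1) x else 0).
  rewrite binzN2 !act_vac.
  have -> : (-1) ^ (- 2) = 1 :> K by rewrite -exprnN sqrrN expr1n invr1.
  have -> : (q + j%:Z == -1) = (j%:Z == - 1 - q) by lia.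
  have -> : (q - 2 - j%:Z == -1) = (j%:Z == q - 1) by lia.
  have [e1|n1] := eqVneq j%:Z (- 1 - q).
    have -> : (j%:Z == q - 1) = false by lia.
    rewrite scaler0 subr0; have -> : 0 - 2 - j%:Z = q - 1 by lia.
    by congr (_ *: _); rewrite pmulrn -mulrNz; congr (_%:~R); lia.
  have [e2|n2] := eqVneq j%:Z (q - 1); last by rewrite raddf0 scaler0 subr0 scaler0.
  rewrite raddf0 sub0r scale1r add0r e2 scalerN scaleNr; congr (- (_ *: _)).
  by rewrite pmulrn; congr (_%:~R); lia.
move=> ->; [|by case=> // j _; rewrite (binz_nat _ 0) bin0n scale0r|]; last first.
  by move=> j hj; rewrite hF; case: ifP => // h1; exfalso; lia.
under eq_bigr => j _ do rewrite hF.
(* For q = 0 both candidate indices are -1 and no term survives; otherwise the surviving index is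
   |q| - 1. *)
have [->|q0] := eqVneq q 0.
  by rewrite mulr0z !oppr0 scale0r big1 // => j _; case: ifP.
have hj : (`|q|.-1 < 1 + `|q|)%N by lia.
rewrite (bigD1 (Ordinal hj)) //= big1 ?addr0; last first.
  by move=> j /eqP hne; case: ifP => // h1; case: hne; apply: val_inj => /=; lia.
by case: ifP => // h1; exfalso; lia.
Qed.

(* The Borcherds identity with [p] the weight [d] of [a], as in Zhu's product: all
   terms [act b _ (act a (p + j) x)] vanish. *)
Lemma zhu_step a b x (d s m : nat) (e : int) :
  (forall j : nat, act a (d%:Z + j%:Z) x = 0) ->
  (forall j : nat, act b (e + j%:Z) x = 0) ->
  \sum_(j < d.+1) ('C(d, j))%:R *:
     act (nprod a (- s.+1%:Z + j%:Z) b) (d%:Z + s%:Z + e - 1 + m%:Z - j%:Z) x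
  = if (s == 0)%N && (m == 0)%N then act a (d%:Z - 1) (act b (e - 1) x) else 0.
Proof.
move=> ha hb.
have := @borcherds_cut a b x d (e + s%:Z - 1 + m%:Z) (- s.+1%:Z) d.+1 1.
rewrite big_ord1 binz0 expr0 mulr1 scale1r !addr0.
have := ha 0%N; rewrite addr0 => ->; rewrite raddf0 scaler0 subr0 => hs.
transitivity (act a (d%:Z - s.+1%:Z) (act b (e + s%:Z - 1 + m%:Z) x)).
  rewrite -hs.
  - by apply: eq_bigr => j _; rewrite binz_nat; congr (_ *: act _ _ _); lia.
  - by move=> j hj; rewrite binz_nat bin_small // scale0r.
  - case=> // j _; rewrite ha raddf0 scaler0 subr0.
    have -> : e + s%:Z - 1 + m%:Z + j.+1%:Z = e + (s + m + j)%N%:Z by lia.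
    by rewrite hb raddf0 scaler0.
(* Unless s = m = 0, the mode of [b] has index at least [e] and kills [x]. *)
case: ifP => [/andP[/eqP-> /eqP->]|hsn]; first by rewrite !addr0.
have -> : e + s%:Z - 1 + m%:Z = e + (s + m).-1%:Z by lia.
by rewrite hb raddf0.
Qed.

End Modes.

(** * Cyclic submodules *)

Section Submodules.
Variables (K : numFieldType) (V : vertexAlgebra K) (M : vmodule V).
Implicit Types (a b : V) (x : M) (n p q r : int).

Definition cyclic (x y : M) : Prop :=
  forall N : M -> Prop, is_submodule N -> N x -> N y.

Lemma cyclic_submodule x : is_submodule (cyclic x).
Proof.
split=> [N [N0 _ _] _ //|c y z hy hz N hN Nx|a n y hy N hN Nx].
- by case: (hN) => _ h _; apply: h; [apply: hy | apply: hz].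
- by case: (hN) => _ _; apply; apply: hy.
Qed.

Definition modes_of (x y : M) : Prop := exists a n, y = act a n x.

(* Downward induction on [q], since [act b q x = 0] for large [q]: choosing [p]
   large in the Borcherds identity isolates [a_(p) b_(q) x] up to terms
   [a_(p-j) b_(q+j) x] with [j > 0]. *)
Lemma act_act_span a b p q x : lin_span (modes_of x) (act a p (act b q x)).
Proof.
have hS := lin_span_subspace (modes_of x).
have [N hN] := act_trunc b x.
have [m hm] : exists m : nat, N%:Z <= q + m%:Z by exists (N + `|q|)%N; lia.
elim: m p q hm => [|m IH] p q hm.
  have -> : q = (`|q|%N)%:Z by lia.
  by rewrite hN ?raddf0; [apply: hS.1|lia].
have [P hP] := act_trunc a x.
have [N0 h] := borcherds_trunc a b x P%:Z q (p - P%:Z).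
have := h N0.+1 (leqnSn _).
rewrite [RHS]big_ord_recl /= expr0 binz0 mulr1 scale1r !addr0 hP // raddf0 scaler0.
have -> : P%:Z + (p - P%:Z) = p by lia.
move/eqP; rewrite subr0 -subr_eq => /eqP <-.
apply: (subspaceB hS); apply: (subspace_sum hS) => j _; apply: (subspaceZ hS).
  by apply: lin_span_incl; do 2 eexists.
rewrite -[P%:Z + _]PoszD hP ?leq_addr // raddf0 scaler0 subr0.
by apply: IH; rewrite /bump /=; lia.
Qed.

Lemma modes_span_submodule x : is_submodule (lin_span (modes_of x)).
Proof.
have [h1 h2] := lin_span_subspace (modes_of x); split=> // a n y hy.
apply: (hy (fun y => lin_span (modes_of x) (act a n y))).
  by apply: subspace_preim => //; apply: act_linearr.
by move=> _ [b [q ->]]; apply: act_act_span.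
Qed.

Lemma cyclic_modes x y : cyclic x y -> lin_span (modes_of x) y.
Proof.
apply; first exact: modes_span_submodule.
by apply: lin_span_incl; exists (vac V), (-1); rewrite act_vac eqxx.
Qed.

Lemma irreducible_cyclic x y : irreducible M -> x != 0 -> cyclic x y.
Proof.
move=> [_ irr] x0; have [h|//] := irr _ (cyclic_submodule x).
by move/eqP: x0; case; apply: h => N _.
Qed.

End Submodules.

(** * Conformal weights and singular vectors *)

Section Weights.
Variables (K : numFieldType) (V : vertexAlgebra K) (L : V).
Hypothesis L_transl : forall a, nprod L 0 a = transl a.

(** [nprod L 1] is L_0. Weights are integers because products of large index have formally negative
    weight. *)
Definition wt (e : int) (a : V) : Prop := nprod L 1 a = e%:~R *: a.

Lemma wt_subspace e : subspace (wt e).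
Proof.
split=> [|c a b ha hb]; rewrite /wt; first by rewrite !raddf0.
by rewrite nprod_linearr ha hb scalerDr !scalerA [c * _]mulrC.
Qed.

(** In the commutator of L_0 with a_(n), [nprod L 0 a] contributes -(n + 1) by [act_transl] and
    [nprod L 1 a] contributes [e]. *)
Lemma act_wt (M : vmodule V) e a n (x : M) : wt e a ->
  act L 1 (act a n x) = act a n (act L 1 x) + (e - n - 1)%:~R *: act a n x.
Proof.
move=> ha; rewrite act_comm1 L_transl act_transl ha actZl.
rewrite (_ : 1 + n - 1 = n); last by lia.
rewrite -scalerDl.
congr (_ + _ *: _).
by rewrite -mulrNz -intrD; congr _%:~R; lia.
Qed.

Lemma act_wt_eigen (M : vmodule V) e a n (x : M) c : wt e a ->
  act L 1 x = c *: x ->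
  act L 1 (act a n x) = (c + (e - n - 1)%:~R) *: act a n x.
Proof. by move=> ha hx; rewrite (act_wt _ _ ha) hx linearZ scalerDl. Qed.

Lemma wt_nprod d e n a b : wt d a -> wt e b -> wt (d + e - n - 1) (nprod a n b).
Proof.
move=> ha hb.
have := @act_wt_eigen (adjoint V) d a n b e%:~R ha hb; rewrite /wt /= => ->.
by rewrite -intrD; congr (_%:~R *: _); lia.
Qed.

Lemma wt_vac : wt 0 (vac V).
Proof. by rewrite /wt scale0r (nprod_vacr0 L 1). Qed.

End Weights.

(** * Weight induction and singular vectors under strong generation *)

Section StronglyGenerated.
Variables (K : numFieldType) (V : vertexAlgebra K) (L : V).
Hypothesis L_transl : forall a, nprod L 0 a = transl a.
Variables (m : nat) (X : m.-tuple V) (d : 'I_m -> nat).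
Hypothesis d_gt0 : forall i, (0 < d i)%N.
Hypothesis wt_gen : forall i, wt L (d i) (tnth X i).
Hypothesis pbw_span : forall v : V,
  exists (s : seq (seq ('I_m * nat))) (c : seq ('I_m * nat) -> K),
    v = \sum_(w <- s) c w *: monomial X w.

Definition mwt (w : seq ('I_m * nat)) : nat := \sum_(l <- w) (d l.1 + l.2).

Lemma mwt_cons l w : mwt (l :: w) = (d l.1 + l.2 + mwt w)%N.
Proof. by rewrite /mwt big_cons. Qed.

Lemma wt_monomial w : wt L (mwt w) (monomial X w).
Proof.
elim: w => [|l w IH]; first by rewrite /mwt big_nil; apply: wt_vac.
rewrite mwt_cons /=.
have := wt_nprod L_transl (- (l.2.+1)%:Z) (wt_gen l.1) IH.
by congr (wt L _ _); lia.
Qed.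

Lemma mwt_eq0 w : mwt w = 0%N -> w = [::].
Proof. by case: w => // l w; rewrite mwt_cons; have := d_gt0 l.1; lia. Qed.

Let L1 : {linear V -> V} := @nprod K V L 1.

(** Monomials are L_0-eigenvectors: those of weight [e] in an expansion of [a] make up [t], the
    others [y]. *)
Lemma wt_split (e : int) a : exists t y, [/\ a = t + y, off_eig L1 e%:~R y, wt L e t &
  lin_span (fun b => exists2 w, (mwt w)%:Z = e & b = monomial X w) t].
Proof.
have [s [c ->]] := pbw_span a.
exists (\sum_(w <- s | (mwt w)%:Z == e) c w *: monomial X w).
exists (\sum_(w <- s | (mwt w)%:Z != e) c w *: monomial X w).
split; first by rewrite (bigID (fun w => (mwt w)%:Z == e)).
- apply: (subspace_sum (off_eig_subspace _ _)) => w hw.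
  apply: (subspaceZ (off_eig_subspace _ _)).
  by apply: off_eig_eigen (wt_monomial w) _; rewrite eqr_int.
- apply: (subspace_sum (wt_subspace _ _)) => w /eqP <-.
  by apply: (subspaceZ (wt_subspace _ _)); apply: wt_monomial.
- apply: (subspace_sum (lin_span_subspace _)) => w /eqP hw.
  by apply: (subspaceZ (lin_span_subspace _)); apply: lin_span_incl; exists w.
Qed.

Lemma wt_monomials e a : wt L e a ->
  lin_span (fun b => exists2 w, (mwt w)%:Z = e & b = monomial X w) a.
Proof.
move=> ha; have [t [y [hty hy ht]]] := wt_split e a.
by rewrite (eig_uniq (f := L1) ha ht hy hty).
Qed.

(** The induction is on weights, not on lengths of monomials: the Borcherds identity for X_(-n-1) b
    brings in other products of X and b, which have smaller weight but need not be monomials. *)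
Lemma wt_ind (P : int -> V -> Prop) :
  (forall e, subspace (P e)) -> P 0 (vac V) ->
  (forall i n e b, wt L e b ->
     (forall e' a', e' < (d i + n)%N%:Z + e -> wt L e' a' -> P e' a') ->
     P ((d i + n)%N%:Z + e) (nprod (tnth X i) (- n.+1%:Z) b)) ->
  forall e a, wt L e a -> P e a.
Proof.
move=> hP P0 PS e a.
(* Monomials have nonnegative weight, so none occurs when D = 0. *)
have [D] : exists D : nat, e < D by exists `|e|.+1; lia.
elim: D e a => [|D IH] e a hD ha; apply: (wt_monomials ha) => // _ [[|l w] hw ->] //=.
- by lia.
- by move: hw; rewrite mwt_cons; lia.
- by rewrite -hw /mwt big_nil.
rewrite -hw mwt_cons PoszD; apply: PS; first exact: wt_monomial.
by move=> e' a' he'; apply: IH; move: hw; rewrite mwt_cons; lia.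
Qed.

Section Module.
Variable M : vmodule V.
Implicit Types x : M.

(** For a generator of weight d, index d + j is the mode j + 1 in conformal numbering and index d -
    1 the zero mode; so these vectors are killed by all positive modes of the generators. *)
Definition singular (x : M) : Prop :=
  forall i (j : nat), act (tnth X i) (d i + j)%N x = 0.

Lemma singular_subspace : subspace singular.
Proof.
split=> [|c x y hx hy] i j; first by rewrite raddf0.
by rewrite act_linearr hx hy scaler0 addr0.
Qed.

Lemma singular_act x e a : singular x -> wt L e a ->
  forall j : nat, act a (e + j%:Z) x = 0.
Proof.
move=> hx; move: e a; apply: wt_ind.
- move=> e; split=> [|c a b ha hb] j; first exact: act0l.
  by rewrite actDl actZl ha hb scaler0 addr0.
- by move=> j; rewrite act_vac.
move=> i n e b hb IH j.
(* With m = j + 1 the right side of [zhu_step] is zero. The first term on the left is the wanted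
   mode; the others involve products of smaller weight. *)
have := @zhu_step _ _ M (tnth X i) b x (d i) n j.+1 e; rewrite andbF => h.
have {h} := h _ _; rewrite big_ord_recl bin0 scale1r big1 ?addr0; last first.
  move=> l _.
  have hw := wt_nprod L_transl (- n.+1%:Z + (lift ord0 l)%:Z) (wt_gen i) hb.
  have := IH _ _ _ hw j; rewrite /= /bump /= => h.
  rewrite (_ : _ + _ - _ = (d i)%:Z + e - (- n.+1%:Z + (1 + l)%N%:Z) - 1 + j%:Z); last by lia.
  by rewrite h ?scaler0 //; lia.
move=> h; rewrite -{}h; first by congr (act _ _ _); lia.
  by move=> j'; apply: hx.
by move=> j'; apply: (IH _ _ _ hb); have := d_gt0 i; lia.
Qed.

(** Commuting a positive mode of a generator with the zero mode of [a] gives positive modes of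
    products, which kill [x] by [singular_act]. *)
Lemma singular_wt x e a : singular x -> wt L e a -> singular (act a (e - 1) x).
Proof.
move=> hx ha i j; apply/eqP.
have := @act_comm _ _ M (tnth X i) a x (d i + j)%N (e - 1).
rewrite hx raddf0 subr0 => ->; rewrite big1 // => l _.
have hw := wt_nprod L_transl l%:Z (wt_gen i) ha.
have := singular_act hx hw j => h.
rewrite (_ : _ - _ = (d i)%:Z + e - l%:Z - 1 + j%:Z); last by lia.
by rewrite h scaler0.
Qed.

Section Zero.
Variable T : M -> Prop.
Hypotheses (hT : subspace T) (T_sing : forall x, T x -> singular x).
Hypothesis T_gen : forall i x, T x -> T (act (tnth X i) ((d i)%:Z - 1) x).

(** [zhu_step] with m = 0 reduces the zero mode of X_(-n-1) b to zero modes of products of smaller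
    weight and, for n = 0, the composite of the zero modes of X and b. *)
Lemma zero_mode_stable e a : wt L e a -> forall x, T x -> T (act a (e - 1) x).
Proof.
move: e a; apply: wt_ind.
- move=> e; split=> [|c a b ha hb] x Tx; first by rewrite act0l; apply: hT.1.
  by rewrite actDl actZl; apply: hT.2; [apply: ha | apply: hb].
- by move=> x Tx; rewrite act_vac.
move=> i n e b hb IH x Tx; have hx := T_sing Tx.
have := @zhu_step _ _ M (tnth X i) b x (d i) n 0 e.
rewrite big_ord_recl bin0 scale1r => h.
have {h} := h (fun j => hx i j) (singular_act hx hb).
move/(canRL (addrK _)) => h.
rewrite (_ : act _ _ x = act (nprod (tnth X i) (- n.+1%:Z + 0%:Z) b)
   ((d i)%:Z + n%:Z + e - 1 + 0 - 0) x); last by rewrite addr0; congr (act _ _ _); lia.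
rewrite {}h; apply: (subspaceB hT).
  case: ifP => _; last exact: hT.1.
  by apply: T_gen; apply: (IH _ _ _ hb) Tx; have := d_gt0 i; lia.
apply: (subspace_sum hT) => l _; apply: (subspaceZ hT).
have hw := wt_nprod L_transl (- n.+1%:Z + (lift ord0 l)%:Z) (wt_gen i) hb.
rewrite (_ : _ + _ - _ = (d i)%:Z + e - (- n.+1%:Z + (lift ord0 l)%:Z) - 1 - 1); last by lia.
by apply: (IH _ _ _ hw) Tx; rewrite /= /bump /=; lia.
Qed.

Let actL1 : {linear M -> M} := @act K V M L 1.

(* The weight-[chi] part of the submodule generated by [x] is spanned by the
   images of [x] under zero modes, hence stays inside [T]. *)
Lemma cyclic_top x u chi : T x -> act L 1 x = chi *: x ->
  cyclic x u -> act L 1 u = chi *: u -> T u.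
Proof.
move=> Tx hx /cyclic_modes hu Lu; have hx' := T_sing Tx.
pose N u := exists t y, [/\ u = t + y, off_eig actL1 chi y, act L 1 t = chi *: t & T t].
have hN : subspace N.
  split=> [|c _ _ [t [y [-> hy ht Tt]]] [t' [y' [-> hy' ht' Tt']]]].
    exists 0, 0; rewrite addr0 raddf0 scaler0; split=> //; last exact: hT.1.
    exact: (off_eig_subspace _ _).1.
  exists (c *: t + t'), (c *: y + y'); split.
  - by rewrite scalerDr addrACA.
  - exact: (off_eig_subspace _ _).2.
  - by rewrite act_linearr ht ht' scalerDr !scalerA [c * _]mulrC.
  - exact: hT.2.
have [t [y [e hy ht Tt]]] : N u.
  apply: hu => // _ [a [n ->]].
  have [s [c ->]] := pbw_span a.
  rewrite -/(mode_at n x _) raddf_sum; apply: (subspace_sum hN) => w _.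
  rewrite /= /mode_at actZl; apply: (subspaceZ hN).
  have hw := wt_monomial w; set b := monomial X w in hw *.
  have hb := act_wt_eigen L_transl n hw hx.
  (* Only the zero mode of [b] preserves the L_0-eigenvalue; any other mode lands in another
     eigenspace. *)
  have [en|nn] := eqVneq n ((mwt w)%:Z - 1).
    exists (act b n x), 0; rewrite addr0; split=> //.
    - exact: (off_eig_subspace _ _).1.
    - by rewrite hb en; rewrite (_ : (mwt w)%:Z - _ - 1 = 0) ?addr0 //; lia.
    - by rewrite en; apply: zero_mode_stable.
  exists 0, (act b n x); rewrite add0r raddf0 scaler0; split=> //; last exact: hT.1.
  apply: (off_eig_eigen hb); rewrite -subr_eq0 addrAC subrr add0r intr_eq0.
  by apply: contra nn => /eqP h; apply/eqP; lia.
by rewrite (eig_uniq Lu ht hy e).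
Qed.

End Zero.
End Module.
End StronglyGenerated.

(** * Lowest weight modules of the subregular W-algebra *)

Lemma nprod0l (K : numFieldType) (V : vertexAlgebra K) n (b : V) : nprod 0 n b = 0.
Proof. exact: (act0l (M := adjoint V)). Qed.

Section Subregular.
Variables (K : numFieldType) (V : vertexAlgebra K) (k : K) (J L Gp Gm : V).
Hypothesis hV : is_subregular_W k J L Gp Gm.

Definition gens : 4.-tuple V := [tuple J; L; Gp; Gm].
Definition gen_wt (i : 'I_4) : nat := if (i : nat) is 0%N then 1%N else 2%N.

Lemma gens_ind (P : V -> nat -> Prop) :
  P J 1%N -> P L 2%N -> P Gp 2%N -> P Gm 2%N -> forall i, P (tnth gens i) (gen_wt i).
Proof. by move=> hJ hL hp hm; case=> [[|[|[|[|]]]] // hi]; rewrite (tnth_nth J). Qed.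

Let L_transl : forall a, nprod L 0 a = transl a := let: And3 _ h _ := sW_conformal hV in h.

Lemma gen_wt_gt0 i : (0 < gen_wt i)%N.
Proof. by rewrite /gen_wt; case: (i : nat). Qed.

Lemma wt_J : wt L 1 J.
Proof. exact: (sW_primary_J hV 1). Qed.

Lemma wt_L : wt L 2 L.
Proof. by case: (sW_conformal hV) => h _ _; exact: (h 1%N). Qed.

Lemma wt_gens i : wt L (gen_wt i) (tnth gens i).
Proof.
apply: (gens_ind (P := fun a d => wt L d a)); [exact: wt_J|exact: wt_L| |].
- exact: (sW_primary_Gp hV 1).
- exact: (sW_primary_Gm hV 1).
Qed.

Lemma pbw_span v : exists (s : seq (seq ('I_4 * nat))) (c : seq ('I_4 * nat) -> K),
  v = \sum_(w <- s) c w *: monomial gens w.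
Proof. by have [/(_ v)[s [c [_ ->]]] _] := sW_pbw hV; exists s, c. Qed.

Definition g_poly (chi s : K) : K :=
  s * ((3 + k) * chi + (k + 1) * (k + 2) / 2 - s ^+ 2).

Section LowestWeight.
Variable M : vmodule V.
Implicit Types x v : M.

Notation sing := (singular gens gen_wt).

(** [zhu_step] with d = 1 and s = m = 0, solved for its first term; [nord_L_mode] is the case d =
    2. *)
Lemma nord_J_mode x b e : sing x -> wt L e b ->
  act (nord J b) e x = act J 0 (act b (e - 1) x) - act (nprod J 0 b) (e - 1) x.
Proof.
move=> hx hb.
have hJ (j : nat) : act J (1%N%:Z + j%:Z) x = 0 by apply: (hx ord0 j).
have := zhu_step 0 0 hJ (singular_act L_transl gen_wt_gt0 wt_gens pbw_span hx hb).
rewrite !big_ord_recr big_ord0 /= add0r bin0 bin1 !scale1r => /(canRL (addrK _)) h.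
transitivity (act (nprod J (- 1%N%:Z + 0%N%:Z) b)
                (1%N%:Z + 0%N%:Z + e - 1 + 0%N%:Z - 0%N%:Z) x).
  by congr (act _ _ _); lia.
by rewrite h; congr (_ - act _ _ _); lia.
Qed.

Lemma nord_L_mode x b e : sing x -> wt L e b ->
  act (nord L b) (e + 1) x
  = act L 1 (act b (e - 1) x) - (2 *: act (nprod L 0 b) e x + act (nprod L 1 b) (e - 1) x).
Proof.
move=> hx hb.
have hL (j : nat) : act L (2%N%:Z + j%:Z) x = 0 by apply: (hx (Ordinal (isT : (1 < 4)%N)) j).
have := zhu_step 0 0 hL (singular_act L_transl gen_wt_gt0 wt_gens pbw_span hx hb).
rewrite !big_ord_recr big_ord0 /= add0r bin0 bin1 binn !scale1r -addrA.
move=> /(canRL (addrK _)) h.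
transitivity (act (nprod L (- 1%N%:Z + 0%N%:Z) b)
                (2%N%:Z + 0%N%:Z + e - 1 + 0%N%:Z - 0%N%:Z) x).
  by congr (act _ _ _); lia.
by rewrite h; congr (_ - (_ *: act _ _ _ + act _ _ _)); lia.
Qed.

Lemma wt_transl a e : wt L e a -> wt L (e + 1) (transl a).
Proof.
move=> ha; have := wt_nprod L_transl (-2) ha (wt_vac L).
by rewrite (_ : _ - 1 = e + 1) //; lia.
Qed.

Lemma nprod_J0_nord a b : nprod J 0 a = 0 -> nprod J 0 b = 0 ->
  nprod J 0 (nord a b) = 0.
Proof.
move=> ha hb; have := act_comm0 (M := adjoint V) J a b (-1); rewrite /= => ->.
by rewrite hb ha nprod0l raddf0 addr0.
Qed.

Lemma nprod_J0_transl a : nprod J 0 a = 0 -> nprod J 0 (transl a) = 0.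
Proof.
move=> ha; have := act_comm0 (M := adjoint V) J a (vac V) (-2); rewrite /= => ->.
by rewrite ha nprod0l (nprod_vacr0 J 0) raddf0 addr0.
Qed.

Section Eigenvector.
Variables (x : M) (s chi : K).
Hypotheses (hx : sing x) (Jx : act J 0 x = s *: x) (Lx : act L 1 x = chi *: x).

Lemma J0_J : nprod J 0 J = 0. Proof. exact: (sW_J_J hV 0). Qed.

Lemma JJ_mode : act (nord J J) 1 x = s ^+ 2 *: x.
Proof.
rewrite (nord_J_mode hx wt_J) J0_J act0l subr0 Jx linearZ /= Jx scalerA.
by rewrite expr2.
Qed.

Lemma dJ_mode : act (transl J) 1 x = - s *: x.
Proof. by rewrite act_transl Jx scaleN1r scaleNr. Qed.

Lemma wt_JJ : wt L 2 (nord J J).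
Proof. by have := wt_nprod L_transl (-1) wt_J wt_J. Qed.

Lemma JJJ_mode : act (nord J (nord J J)) 2 x = s ^+ 3 *: x.
Proof.
rewrite (nord_J_mode hx wt_JJ) nprod_J0_nord ?J0_J // act0l subr0 JJ_mode linearZ /= Jx.
by rewrite scalerA -exprSr.
Qed.

Lemma JdJ_mode : act (nord J (transl J)) 2 x = - s ^+ 2 *: x.
Proof.
rewrite (nord_J_mode hx (wt_transl wt_J)) nprod_J0_transl ?J0_J // act0l subr0.
by rewrite dJ_mode linearZ /= Jx scalerA mulNr -expr2.
Qed.

Lemma ddJ_mode : act (transl (transl J)) 2 x = (2 * s) *: x.
Proof. by rewrite act_transl dJ_mode scalerA mulrNN. Qed.

Lemma dL_mode : act (transl L) 2 x = - (2 * chi) *: x.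
Proof. by rewrite act_transl Lx scalerA mulNr. Qed.

(** The corrections in [nord_L_mode] add up to s: 2 s from [transl J] and -s from [J]. *)
Lemma LJ_mode : act (nord L J) 2 x = (s * (chi + 1)) *: x.
Proof.
rewrite (nord_L_mode hx wt_J) L_transl dJ_mode wt_J actZl subrr Jx linearZ /= Lx.
rewrite !scalerA -scalerDl -scalerBl; congr (_ *: _); ring.
Qed.

(** In [act_comm] with m = 1 only the simple and double poles enter. *)
Lemma GpGm_comm :
  act Gp 1 (act Gm 1 x) - act Gm 1 (act Gp 1 x) = g_poly chi s *: x.
Proof.
rewrite (act_comm Gp Gm x 1 1) !big_ord_recr big_ord0 /= add0r bin0 bin1 !scale1r.
have -> : nprod Gp 0%N Gm = _ := sW_Gp_Gm hV 0.
have -> : nprod Gp 1%N Gm = _ := sW_Gp_Gm hV 1.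
rewrite /= /GpGm_pole1 /GpGm_pole2 subr0 (_ : 1%N%:Z + 1 = 2) // (_ : 2 - 1%N%:Z = 1) //.
rewrite !actBl !actDl !actZl.
rewrite LJ_mode dL_mode JJJ_mode JdJ_mode ddJ_mode Lx JJ_mode dJ_mode.
rewrite !scalerA -!scalerBl -!scalerDl -!scalerBl -!scalerDl; congr (_ *: _).
by rewrite /g_poly; field.
Qed.

End Eigenvector.

(** The weight and annihilation conditions of [is_L], with the positive modes of the four generators
    gathered in [sing]. *)
Definition lowest (xi chi : K) v : Prop :=
  [/\ act J 0 v = xi *: v, act L 1 v = chi *: v, sing v & act Gm 1 v = 0].

Definition raise (n : nat) v : M := iter n (act Gp 1) v.

Definition raised_span v : M -> Prop := lin_span (fun y => exists n, y = raise n v).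

(* [g_poly chi s = g_prim chi (s + 1) - g_prim chi s]. *)
Definition g_prim (chi s : K) : K :=
  let t := s * (s - 1) / 2 in ((3 + k) * chi + (k + 1) * (k + 2) / 2 - t) * t.

(** Minus the sum of [g_poly chi (xi + j)] for j from 0 to n, telescoped. *)
Definition lower_coef (xi chi : K) (n : nat) : K :=
  g_prim chi xi - g_prim chi (xi + n.+1%:R).

Section Lowest.
Variables (xi chi : K) (v : M).
Hypothesis hv : lowest xi chi v.

Lemma raise_singular n : sing (raise n v).
Proof.
case: hv => _ _ v_sing _; elim: n => // n IH.
exact: (singular_wt L_transl gen_wt_gt0 wt_gens pbw_span (e := 2) IH (sW_primary_Gp hV 1)).
Qed.

Lemma raise_J n : act J 0 (raise n v) = (xi + n%:R) *: raise n v.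
Proof.
case: hv => Jv _ _ _; elim: n => [|n IH]; first by rewrite addr0.
rewrite /= act_comm0 IH linearZ /=; have -> : nprod J 0 Gp = _ := sW_J_Gp hV 0.
by rewrite -[X in _ + X]scale1r -scalerDl -natr1 addrA.
Qed.

Lemma raise_L n : act L 1 (raise n v) = chi *: raise n v.
Proof.
case: hv => _ Lv _ _; elim: n => [//|n IH].
have hp : wt L 2 Gp by exact: (sW_primary_Gp hV 1).
by rewrite /= (act_wt_eigen L_transl 1 hp IH) addr0.
Qed.

(** Moving G^-_0 past each G^+_0 subtracts [g_poly] at the current J_0-weight. *)
Lemma lower_raise n :
  act Gm 1 (raise n.+1 v) = lower_coef xi chi n *: raise n v.
Proof.
have hcomm j : act Gm 1 (raise j.+1 v)
    = act Gp 1 (act Gm 1 (raise j v)) - g_poly chi (xi + j%:R) *: raise j v.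
  have <- := GpGm_comm (raise_singular j) (raise_J j) (raise_L j).
  by rewrite opprB addrC subrK.
elim: n => [|n IH]; rewrite hcomm.
  case: hv => _ _ _ ->; rewrite raddf0 sub0r -scaleNr; congr (_ *: _).
  by rewrite /g_poly /lower_coef /g_prim /=; field.
rewrite IH linearZ /= -scalerBl; congr (_ *: _).
by rewrite /g_poly /lower_coef /g_prim -!natr1 /=; field.
Qed.

Lemma raised_spanP u : raised_span v u ->
  forall i, raised_span v (act (tnth gens i) ((gen_wt i)%:Z - 1) u).
Proof.
have hS := lin_span_subspace (fun y => exists n, y = raise n v).
have hin n : raised_span v (raise n v) by apply: lin_span_incl; exists n.
move=> hu i; apply: (hu (fun u => raised_span v (act (tnth gens i) ((gen_wt i)%:Z - 1) u))).
  by apply: subspace_preim => //; apply: act_linearr.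
move=> _ [n ->]; move: i.
apply: (gens_ind (P := fun a d => raised_span v (act a (d%:Z - 1) (raise n v)))).
- by rewrite (_ : 1%N%:Z - 1 = 0) // raise_J; apply: (subspaceZ hS); apply: hin.
- by rewrite (_ : 2%N%:Z - 1 = 1) // raise_L; apply: (subspaceZ hS); apply: hin.
- exact: (hin n.+1).
rewrite (_ : 2%N%:Z - 1 = 1) //; case: n => [|n].
  by case: hv => _ _ _ /= ->; exact: hS.1.
by rewrite lower_raise; apply: (subspaceZ hS); apply: hin.
Qed.

Lemma cyclic_raised u : cyclic v u -> act L 1 u = chi *: u -> raised_span v u.
Proof.
move=> hu Lu; case: (hv) => _ Lv _ _.
apply: (cyclic_top L_transl gen_wt_gt0 wt_gens pbw_span (lin_span_subspace _) _ _ _ Lv hu Lu).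
- move=> y hy; apply: hy; first exact: singular_subspace.
  by move=> _ [n ->]; apply: raise_singular.
- by move=> i y hy; apply: raised_spanP.
- by apply: lin_span_incl; exists 0%N.
Qed.

Let J0 : {linear M -> M} := @act K V M J 0.

(** By [cyclic_raised], [u] is a combination of the [raise n v], whose J_0-weights xi + n differ
    from xi for n > 0. *)
Lemma cyclic_lowest u : cyclic v u ->
  act L 1 u = chi *: u -> act J 0 u = xi *: u -> exists c, u = c *: v.
Proof.
move=> hu Lu Ju; have [Jv _ _ _] := hv.
have [c [y [e hy]]] : exists c y, u = c *: v + y /\ off_eig J0 xi y.
  have hO := off_eig_subspace J0 xi.
  apply: (cyclic_raised hu Lu (N := fun u => exists c y, u = c *: v + y /\ off_eig J0 xi y)).
    split=> [|a _ _ [c [y [-> hy]]] [c' [y' [-> hy']]]].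
      by exists 0, 0; rewrite scale0r addr0; split=> //; exact: hO.1.
    exists (a * c + c'), (a *: y + y'); split; last exact: hO.2.
    by rewrite scalerDr scalerDl scalerA addrACA.
  move=> _ [[|n] ->].
    by exists 1, 0; rewrite scale1r addr0; split=> //; exact: hO.1.
  exists 0, (raise n.+1 v); rewrite scale0r add0r; split=> //.
  by apply: (off_eig_eigen (raise_J n.+1)); rewrite -subr_eq0 addrAC subrr add0r pnatr_eq0.
exists c; apply: (eig_uniq (f := J0) Ju _ hy e) => /=.
by rewrite linearZ /= Jv !scalerA mulrC.
Qed.

Lemma cyclic_absent u xi' : (forall n : nat, xi + n%:R != xi') -> cyclic v u ->
  act L 1 u = chi *: u -> act J 0 u = xi' *: u -> u = 0.
Proof.
move=> hxi hu Lu Ju.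
apply: (eig_uniq (f := J0) (y := u) Ju); rewrite ?raddf0 ?add0r //.
apply: (cyclic_raised hu Lu); first exact: off_eig_subspace.
by move=> _ [n ->]; apply: off_eig_eigen (raise_J n) _.
Qed.

Lemma raise_neq0 n : v != 0 -> (forall j, (j < n)%N -> lower_coef xi chi j != 0) ->
  raise n v != 0.
Proof.
move=> v0; elim: n => // n IH hn; apply/eqP => e.
have := lower_raise n; rewrite e raddf0 => /esym/eqP.
rewrite scaler_eq0 (negPf (hn n (ltnSn n))) /=; apply/negP; apply: IH => j hj.
by apply: hn; apply: ltnW.
Qed.

End Lowest.

(** Were it nonzero, [raise n.+1 v] would be a lowest weight vector generating [M]; the J_0-weights
    of the top space would start at xi + n + 1, leaving no room for [v]. *)
Lemma raise_eq0 xi chi v n : irreducible M -> v != 0 -> lowest xi chi v ->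
  lower_coef xi chi n = 0 -> raise n.+1 v = 0.
Proof.
move=> irr v0 hv hn; apply/eqP/negPn/negP => w0.
have hw : lowest (xi + n.+1%:R) chi (raise n.+1 v).
  split; [exact: (raise_J hv)|exact: (raise_L hv)|exact: (raise_singular hv)|].
  by rewrite (lower_raise hv) hn scale0r.
case: hv => Jv Lv _ _; move/eqP: v0; apply.
apply: (cyclic_absent hw _ (irreducible_cyclic v irr w0) Lv Jv) => m.
by rewrite -addrA -natrD -subr_eq0 addrAC subrr add0r pnatr_eq0.
Qed.

Lemma is_LP xi chi : is_L J L Gp Gm xi chi M <->
  irreducible M /\ exists v, v != 0 /\ lowest xi chi v.
Proof.
split=> [[irr [v [v0 _ [Jv Lv] hpos hm]]]|[irr [v [v0 [Jv Lv v_sing mv]]]]];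
  split=> //; exists v.
- move: Jv Lv (hm 0 isT); rewrite /mode !add0r subrr => Jv Lv mv; split=> //; split=> //.
  move=> i j; move: i.
  apply: (gens_ind (P := fun a d => act a (d + j)%N v = 0)).
  + have [h _ _] := hpos j.+1 isT; rewrite -[RHS]h /mode; congr (act _ _ _); lia.
  + have [_ h _] := hpos j.+1 isT; rewrite -[RHS]h /mode; congr (act _ _ _); lia.
  + have [_ _ h] := hpos j.+1 isT; rewrite -[RHS]h /mode; congr (act _ _ _); lia.
  + have h := hm j.+1 isT; rewrite -[RHS]h /mode; congr (act _ _ _); lia.
have hJ (j : nat) : act J (1 + j)%N v = 0 := v_sing ord0 j.
have hL (j : nat) : act L (2 + j)%N v = 0 := v_sing (Ordinal (isT : (1 < 4)%N)) j.
have hp (j : nat) : act Gp (2 + j)%N v = 0 := v_sing (Ordinal (isT : (2 < 4)%N)) j.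
have hm (j : nat) : act Gm (2 + j)%N v = 0 := v_sing (Ordinal (isT : (3 < 4)%N)) j.
split=> //.
- by move=> N hN Nv x; apply: (irreducible_cyclic x irr v0).
- case=> // -[|j] // _; rewrite /mode; split.
  + by rewrite -[RHS](hJ j); congr (act _ _ _); lia.
  + by rewrite -[RHS](hL j); congr (act _ _ _); lia.
  + by rewrite -[RHS](hp j); congr (act _ _ _); lia.
- case=> // -[|j] // _; rewrite /mode //.
  by rewrite -[RHS](hm j); congr (act _ _ _); lia.
Qed.

End LowestWeight.
End Subregular.

(** * Uniqueness of L(xi, chi) *)

Section DirectSum.
Variables (K : numFieldType) (V : vertexAlgebra K) (M N : vmodule V).

Definition dsum_act (a : V) (n : int) (z : M * N) : M * N := (act a n z.1, act a n z.2).

Lemma dsum_linearl n z : linear (fun a => dsum_act a n z).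
Proof.
move=> c a b; apply: injective_projections => /=; exact: act_linearl.
Qed.

Lemma dsum_linearr a n : linear (dsum_act a n).
Proof.
move=> c x y; apply: injective_projections => /=; exact: act_linearr.
Qed.

Lemma dsum_trunc a z :
  exists n : nat, forall j : nat, (n <= j)%N -> dsum_act a j%:Z z = 0.
Proof.
have [n1 h1] := act_trunc a z.1; have [n2 h2] := act_trunc a z.2.
exists (maxn n1 n2) => j; rewrite geq_max => /andP[l1 l2].
by rewrite /dsum_act h1 // h2.
Qed.

Lemma dsum_vac n z : dsum_act (vac V) n z = if n == -1 then z else 0.
Proof. by rewrite /dsum_act !act_vac; case: ifP => // _; case: z. Qed.

Lemma dsum_borcherds : borcherds (@nprod K V) dsum_act.
Proof.
move=> a b z p q r n h.
have h1 j : (n <= j)%N -> [/\ nprod a (r + j%:Z) b = 0, act b (q + j%:Z) z.1 = 0 &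
    act a (p + j%:Z) z.1 = 0] by move=> /h[-> [-> _] [-> _]].
have h2 j : (n <= j)%N -> [/\ nprod a (r + j%:Z) b = 0, act b (q + j%:Z) z.2 = 0 &
    act a (p + j%:Z) z.2 = 0] by move=> /h[-> [_ ->] [_ ->]].
apply: injective_projections; rewrite !raddf_sum /=.
  exact: act_borcherds h1.
exact: act_borcherds h2.
Qed.

Definition dsum : vmodule V :=
  VModule dsum_linearl dsum_linearr dsum_trunc dsum_vac dsum_borcherds.

End DirectSum.

Section Uniqueness.
Variables (K : numFieldType) (V : vertexAlgebra K) (M N : vmodule V).

(** The [y] with (0, y) in [P] form a submodule of the irreducible [N], proper by assumption and so
    zero. *)
Lemma functional_submodule (P : dsum M N -> Prop) : irreducible N -> is_submodule P ->
  (exists y, ~ P (0, y)) -> forall x y y', P (x, y) -> P (x, y') -> y = y'.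
Proof.
move=> [_ irr] [P0 PD Pa] [z hz] x y y' hy hy'.
have hsub : is_submodule (fun y => P (0, y)).
  split=> [|c u w hu hw|a n u hu]; first exact: P0.
    by have := PD c _ _ hu hw; congr P; congr pair; rewrite /= scaler0 addr0.
  by have := Pa a n _ hu; congr P; congr pair; rewrite /= raddf0.
have [h|h] := irr _ hsub; last by case: hz; apply: h.
apply/eqP; rewrite -subr_eq0; apply/eqP; apply: h.
have := PD (-1) _ _ hy' hy; congr P; congr pair; rewrite /= scaleN1r addrC ?subrr //.
Qed.

Lemma total_submodule (P : dsum M N -> Prop) x0 y0 : irreducible M -> is_submodule P ->
  x0 != 0 -> P (x0, y0) -> forall x, exists y, P (x, y).
Proof.
move=> [_ irr] [P0 PD Pa] hx0 h0.
have hsub : is_submodule (fun x => exists y, P (x, y)).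
  split; first by exists 0; exact: P0.
  + move=> c x x' [y hy] [y' hy']; exists (c *: y + y').
    exact: PD hy hy'.
  + by move=> a n x [y hy]; exists (act a n y); exact: Pa hy.
have [h|//] := irr _ hsub.
by move/eqP: hx0; case; apply: h; exists y0.
Qed.

End Uniqueness.

(** Through the swap, the same two lemmas show that the graph is that of a bijection. *)
Definition dsum_swap (K : numFieldType) (V : vertexAlgebra K) (M N : vmodule V)
  (z : dsum M N) : dsum N M := (z.2, z.1).

Section UniqueL.
Variables (K : numFieldType) (V : vertexAlgebra K) (k : K) (J L Gp Gm : V).
Hypothesis hV : is_subregular_W k J L Gp Gm.

Lemma dsum_lowest (M N : vmodule V) xi chi (v : M) (w : N) :
  lowest J L Gp Gm xi chi v -> lowest J L Gp Gm xi chi w ->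
  lowest (M := dsum M N) J L Gp Gm xi chi (v, w).
Proof.
move=> [Jv Lv sv mv] [Jw Lw sw mw]; split.
- by rewrite /= /dsum_act /= Jv Jw.
- by rewrite /= /dsum_act /= Lv Lw.
- by move=> i j; rewrite /= /dsum_act /= sv sw.
- by rewrite /= /dsum_act /= mv mw.
Qed.

(* The submodule of [M (+) N] generated by the pair of lowest weight vectors is
   the graph of an isomorphism. *)
Lemma is_L_unique xi chi (M N : vmodule V) :
  is_L J L Gp Gm xi chi M -> is_L J L Gp Gm xi chi N -> viso M N.
Proof.
move=> /is_LP[irrM [v [v0 hv]]] /is_LP[irrN [w [w0 hw]]].
pose P := @cyclic K V (dsum M N) (v, w).
have hP : is_submodule P by apply: cyclic_submodule.
have Pvw : P (v, w) by move=> Q _.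
have hvw := dsum_lowest hv hw.
have [Jv Lv _ _] := hv; have [Jw Lw _ _] := hw.
(* Vectors of weights (xi, chi) in [P] are multiples of (v, w); one equal to (0, w) has coefficient
   0, whence w = 0. *)
have n1 : ~ P (0, w).
  move=> /(cyclic_lowest hV hvw)[||c [e1 e2]].
  - by rewrite /= /dsum_act /= Lw raddf0; apply: injective_projections => //=; rewrite scaler0.
  - by rewrite /= /dsum_act /= Jw raddf0; apply: injective_projections => //=; rewrite scaler0.
  move: e1 => /esym/eqP; rewrite scaler_eq0 (negPf v0) orbF => /eqP c0.
  by move: w0; rewrite e2 c0 scale0r eqxx.
have n2 : ~ P (v, 0).
  move=> /(cyclic_lowest hV hvw)[||c [e1 e2]].
  - by rewrite /= /dsum_act /= Lv raddf0; apply: injective_projections => //=; rewrite scaler0.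
  - by rewrite /= /dsum_act /= Jv raddf0; apply: injective_projections => //=; rewrite scaler0.
  move: e2 => /esym/eqP; rewrite scaler_eq0 (negPf w0) orbF => /eqP c0.
  by move: v0; rewrite e1 c0 scale0r eqxx.
have [P0 PD Pa] := hP.
pose Q (z : dsum N M) := P (dsum_swap z).
have hQ : is_submodule Q.
  by split=> [|c x y hx hy|a n x hx]; [exact: P0|exact: PD hx hy|exact: Pa hx].
have fun1 := functional_submodule irrN hP (ex_intro _ w n1).
have fun2 := functional_submodule irrM hQ (ex_intro _ v n2).
have tot1 := total_submodule irrM hP v0 Pvw.
have tot2 := total_submodule irrN hQ w0 (Pvw : Q (w, v)).
pose f x := sval (boolp.cid (tot1 x)); pose g y := sval (boolp.cid (tot2 y)).
have hf x : P (x, f x) by rewrite /f; case: boolp.cid.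
have hg y : P (g y, y) by rewrite /g; case: boolp.cid.
exists f; split.
- by move=> c x y; apply: fun1 (hf _) _; apply: PD (hf x) (hf y).
- exists g => [x|y]; first by apply: fun2 (hg (f x)) (hf x).
  by apply: fun1 (hf (g y)) (hg y).
- by move=> a n x; apply: fun1 (hf _) _; apply: Pa (hf x).
Qed.

End UniqueL.

(** * Twisting *)

Lemma viso_pullback (K : numFieldType) (V W : vertexAlgebra K) (f : vhom V W)
  (M N : vmodule W) : viso M N -> viso (pullback f M) (pullback f N).
Proof. by move=> [g [lg bg hg]]; exists g; split=> // a n x; apply: hg. Qed.

Section Twist.
Variables (K : numFieldType) (V : vertexAlgebra K) (Phi : vhom V V).
Hypothesis Phi_bij : bijective Phi.

Lemma twist_viso M N : viso (twist Phi M) (twist Phi N) -> viso M N.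
Proof.
case: Phi_bij => Psi _ PsiK [g [lg bg hg]]; exists g; split=> // a n x.
by have := hg (Psi a) n x; rewrite /= /pb_act PsiK.
Qed.

Lemma twist_irreducible M : irreducible M -> irreducible (twist Phi M).
Proof.
case: Phi_bij => Psi _ PsiK [ex irr]; split=> // N [N0 ND Na]; apply: irr.
split=> // a n x Nx; by have := Na (Psi a) n x Nx; rewrite /= /pb_act PsiK.
Qed.

End Twist.

Section TwistL.
Variables (K : numFieldType) (V : vertexAlgebra K) (k : K) (J L Gp Gm : V).
Hypothesis hV : is_subregular_W k J L Gp Gm.
Variable Phi : vhom V V.
Hypotheses (Phi_bij : bijective Phi) (Phi_L : Phi L = L) (Phi_J : Phi J = - J).
Hypotheses (Phi_Gp : Phi Gp = Gm) (Phi_Gm : Phi Gm = Gp).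

(** The square of [Phi] fixes the generators, hence the monomials, which span [V]. *)
Lemma PhiK a : Phi (Phi a) = a.
Proof.
have hgen i : Phi (Phi (tnth (gens J L Gp Gm) i)) = tnth (gens J L Gp Gm) i.
  apply: (gens_ind (P := fun a _ => Phi (Phi a) = a)).
  - by rewrite Phi_J raddfN /= Phi_J opprK.
  - by rewrite !Phi_L.
  - by rewrite Phi_Gp Phi_Gm.
  - by rewrite Phi_Gm Phi_Gp.
have [s [c ->]] := pbw_span hV a; rewrite !raddf_sum; apply: eq_bigr => w _.
rewrite /= !linearZ /=; congr (_ *: _).
elim: w => [|l w IH] /=; first by rewrite !vhom_vac.
by rewrite !vhom_nprod hgen IH.
Qed.

Lemma twist_twist (M : vmodule V) : viso (twist Phi (twist Phi M)) M.
Proof.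
exists id; split=> //; first by exists id.
by move=> a n x; rewrite /= /pb_act /= /pb_act PhiK.
Qed.

(* The top space is [v, G^+_0 v, ..., (G^+_0)^n v]; its highest weight vector is
   the lowest weight vector for the twisted action. *)
Lemma twist_is_L xi chi n (M : vmodule V) :
  (forall j, (j < n)%N -> lower_coef k xi chi j != 0) -> lower_coef k xi chi n = 0 ->
  is_L J L Gp Gm xi chi M -> is_L J L Gp Gm (- (xi + n%:R)) chi (twist Phi M).
Proof.
move=> hj hn /is_LP[irr [v [v0 hv]]]; apply/is_LP.
split; first exact: twist_irreducible.
exists (raise Gp n v); split; first exact: (raise_neq0 hV hv v0 hj).
have hs := raise_singular hV hv n; split; rewrite /= /pb_act.
- by rewrite Phi_J actNl (raise_J hV hv) scaleNr.
- by rewrite Phi_L (raise_L hV hv).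
- move=> i j; move: i; rewrite /= /pb_act.
  apply: (gens_ind (P := fun a d => act (Phi a) (d + j)%N (raise Gp n v) = 0)).
  + by rewrite Phi_J actNl (hs ord0 j) oppr0.
  + by rewrite Phi_L (hs (Ordinal (isT : (1 < 4)%N)) j).
  + by rewrite Phi_Gp (hs (Ordinal (isT : (3 < 4)%N)) j).
  + by rewrite Phi_Gm (hs (Ordinal (isT : (2 < 4)%N)) j).
(* In the twisted module G^-_0 acts as G^+_0, so the condition is that (G^+_0)^(n+1) v vanishes. *)
- by rewrite Phi_Gm -[act _ _ _]/(raise Gp n.+1 v) (raise_eq0 hV irr v0 hv hn).
Qed.

(** * Descent of the automorphism to the simple quotient *)

Section Quotient.
Variables (S : vertexAlgebra K) (pi : vhom V S).
Hypothesis hS : is_simple_quotient pi.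

(* [pi (Phi (ker pi))] is an ideal of [S]. Were it all of [S], then
   [pi (Phi a) = vac] with [a] in [ker pi]; but the weight 0 part of [a] lies in
   [ker pi] and is a multiple of [vac], so it vanishes, and so does that of
   [Phi a]. *)
Lemma ker_stable a : pi a = 0 -> pi (Phi a) = 0.
Proof.
have [pi_surj [vacS0 simple]] := hS => pa.
have [Psi PsiK PhiPsi] := Phi_bij.
have hI : is_ideal (fun b => exists2 c, pi c = 0 & b = pi (Phi c)).
  split; first by exists 0; rewrite ?raddf0.
    move=> c _ _ [x px ->] [y py ->]; exists (c *: x + y).
      by rewrite vhom_linear px py scaler0 addr0.
    by rewrite !vhom_linear.
  move=> s _ n [x px ->]; have [y <-] := pi_surj s; rewrite -[y]PhiPsi.
  split; [exists (nprod (Psi y) n x)|exists (nprod x n (Psi y))]; rewrite ?vhom_nprod //.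
    by rewrite px raddf0.
  by rewrite px nprod0l.
have [|/(_ (vac S))[{pa}b pb hb]] := simple _ hI; first by apply; exists a.
exfalso.
have L_transl : forall a, nprod L 0 a = transl a by case: (sW_conformal hV).
have [t [y [e hy wt_t ht]]] := wt_split L_transl (@wt_gens _ _ _ _ _ _ _ hV) (pbw_span hV) 0 b.
set L1 : {linear V -> V} := @nprod K V L 1 in hy.
have [c tE] : exists c, t = c *: vac V.
  apply: (ht (fun t => exists c, t = c *: vac V)); first split.
  - by exists 0; rewrite scale0r.
  - move=> c _ _ [c1 ->] [c2 ->]; exists (c * c1 + c2).
    by rewrite scalerDl scalerA.
  move=> _ [w hw ->]; exists 1; rewrite scale1r.
  by rewrite (mwt_eq0 gen_wt_gt0 (w := w)) //; case: hw.
have hN : subspace (fun x => pi x = 0).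
  split=> [|d x z px pz]; first exact: raddf0.
  by rewrite vhom_linear px pz scaler0 addr0.
have NL x : pi x = 0 -> pi (L1 x) = 0 by move=> px; rewrite vhom_nprod px raddf0.
(* The kernel is stable under L_0, so it contains the weight 0 component of [b]. *)
have pt : pi t = 0 by apply: (eig_component hN NL wt_t hy); rewrite -e.
have t0 : t = 0.
  move: pt; rewrite tE linearZ /= vhom_vac => /eqP; rewrite scaler_eq0 (negPf vacS0) orbF.
  by move/eqP=> ->; rewrite scale0r.
(* [Phi] fixes [L], hence commutes with L_0. *)
have offPhi : off_eig L1 0 (- Phi y).
  case: hy => s hs sy; exists s => //.
  have h x : eig_op L1 s (Phi x) = Phi (eig_op L1 s x).
    elim: s {hs sy} => //= mu s ->; rewrite -[in LHS]Phi_L -vhom_nprod.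
    by rewrite -scaleNr addrC -vhom_linear addrC scaleNr.
  by rewrite -raddfN h -scaleN1r -[_ *: _]addr0 eig_op_linear sy eig_op0 scaler0 addr0 raddf0.
(* Since b = y and pi (Phi b) = vac, the kernel contains [vac V - Phi y], hence its weight 0
   component [vac V]. *)
have : pi (vac V) = 0.
  apply: (eig_component hN NL _ offPhi); first exact: (wt_vac L).
  by rewrite raddfB /= vhom_vac hb e t0 add0r subrr.
by rewrite vhom_vac; apply/eqP.
Qed.

(** Defined through chosen preimages under [pi]; by [ker_stable] the choice does not matter. *)
Lemma descend : exists PhiS : vhom S S, forall a, PhiS (pi a) = pi (Phi a).
Proof.
have [pi_surj _] := hS.
pose sec s := sval (boolp.cid (pi_surj s)).
have secK s : pi (sec s) = s by rewrite /sec; case: boolp.cid.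
pose F s := pi (Phi (sec s)).
have FE a : F (pi a) = pi (Phi a).
  apply/eqP; rewrite -subr_eq0 -!raddfB /=; apply/eqP; apply: ker_stable.
  by rewrite raddfB /= secK subrr.
have Flin : linear F.
  by move=> c s u; rewrite -[s]secK -[u]secK -vhom_linear !FE !vhom_linear.
have Fvac : F (vac S) = vac S by rewrite -(vhom_vac pi) FE !vhom_vac.
have Fn s n u : F (nprod s n u) = nprod (F s) n (F u).
  by rewrite -[s]secK -[u]secK -vhom_nprod !FE !vhom_nprod.
by exists (VHom Flin Fvac Fn).
Qed.

Lemma twist_simple_quotient_module M :
  simple_quotient_module pi M -> simple_quotient_module pi (twist Phi M).
Proof.
move=> [irr [N [f [lf bf hf]]]]; split; first exact: twist_irreducible.
have [PhiS hPhiS] := descend.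
exists (pullback PhiS N), f; split=> // a n x.
by rewrite /= /pb_act hf /= /pb_act /= /pb_act hPhiS.
Qed.

End Quotient.
End TwistL.

(** * Weights of the admissible modules *)

Section Arithmetic.
Variables (K : numFieldType) (k : K) (c : admissible_case) (p : nat).
Hypothesis hk : admissible c p k.

(** Clearing denominators, 3 (respectively 4, with p odd) divides neither p nor 2 p. *)
Lemma admissible_nonint (z : int) : k + 3 + z%:~R != 0 /\ 2 * (k + 3) + z%:~R != 0.
Proof.
move: hk; case: c => /= -[p_ge cp ->].
- have p3 : (p %% 3 != 0)%N by move: cp; rewrite coprime_sym prime_coprime.
  split; apply/eqP => e.
  + have /eqP : (p%:Z + 3 * z)%:~R = 0 :> K.
      by rewrite intrD intrM -pmulrn -[RHS](mulr0 3) -e; field.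
    by rewrite intr_eq0 => /eqP; lia.
  + have /eqP : (2 * p%:Z + 3 * z)%:~R = 0 :> K.
      by rewrite intrD !intrM -pmulrn -[RHS](mulr0 3) -e; field.
    by rewrite intr_eq0 => /eqP; lia.
- have p2 : (p %% 2 != 0)%N by move: cp; rewrite coprime_sym prime_coprime.
  split; apply/eqP => e.
  + have /eqP : (p%:Z + 4 * z)%:~R = 0 :> K.
      by rewrite intrD intrM -pmulrn -[RHS](mulr0 4) -e; field.
    by rewrite intr_eq0 => /eqP; lia.
  + have /eqP : (2 * p%:Z + 4 * z)%:~R = 0 :> K.
      by rewrite intrD !intrM -pmulrn -[RHS](mulr0 4) -e; field.
    by rewrite intr_eq0 => /eqP; lia.
Qed.

Lemma k3_neq0 : k + 3 != 0.
Proof. by have [] := admissible_nonint 0; rewrite addr0. Qed.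

(** The coefficient is quartic in n + 1, and for these weights it splits with 0 and [i] among its
    roots. *)
Lemma lower_coef_xi s i j n :
  lower_coef k (xi k s i j) (chi k s i j) n
  = n.+1%:R * (n.+1%:R - i%:R) / 4 *
    match s with
    | First => (k + 3 - j%:R - n.+1%:R) * (i%:R + j%:R - (k + 3) - n.+1%:R)
    | Second => (2 * (k + 3) - 2 * i%:R - j%:R + n.+1%:R)
                * (2 * (k + 3) - i%:R - j%:R + n.+1%:R)
    | Third => (k + 3 - i%:R - j%:R + n.+1%:R) * (k + 3 - j%:R + n.+1%:R)
    end.
Proof.
have k0 := k3_neq0.
by case: s; rewrite /lower_coef /g_prim /xi /chi /=; field; rewrite addrC.
Qed.

(** The last two factors are, up to sign, k + 3 or 2 (k + 3) plus an integer. *)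
Lemma lower_coef_xi_eq0 s i j n :
  (lower_coef k (xi k s i j) (chi k s i j) n == 0) = (n.+1 == i).
Proof.
rewrite lower_coef_xi !mulf_eq0 invr_eq0 !pnatr_eq0 /= orbF subr_eq0 eqr_nat.
suff /negPf-> : match s with
    | First => (k + 3 - j%:R - n.+1%:R) * (i%:R + j%:R - (k + 3) - n.+1%:R)
    | Second => (2 * (k + 3) - 2 * i%:R - j%:R + n.+1%:R)
                * (2 * (k + 3) - i%:R - j%:R + n.+1%:R)
    | Third => (k + 3 - i%:R - j%:R + n.+1%:R) * (k + 3 - j%:R + n.+1%:R)
    end != 0 by rewrite orbF.
have h1 z x : x = k + 3 + z%:~R -> x != 0 by move=> ->; case: (admissible_nonint z).
have h2 z x : x = 2 * (k + 3) + z%:~R -> x != 0 by move=> ->; case: (admissible_nonint z).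
case: s; apply: mulf_neq0.
- by apply: (h1 (- j%:Z - n.+1%:Z)); rewrite intrB mulrNz -!pmulrn; ring.
- rewrite -oppr_eq0; apply: (h1 (n.+1%:Z - i%:Z - j%:Z)).
  by rewrite !intrB -!pmulrn; ring.
- by apply: (h2 (n.+1%:Z - 2 * i%:Z - j%:Z)); rewrite !intrB intrM -!pmulrn; ring.
- by apply: (h2 (n.+1%:Z - i%:Z - j%:Z)); rewrite !intrB -!pmulrn; ring.
- by apply: (h1 (n.+1%:Z - i%:Z - j%:Z)); rewrite !intrB -!pmulrn; ring.
- by apply: (h1 (n.+1%:Z - j%:Z)); rewrite !intrB -!pmulrn; ring.
Qed.

End Arithmetic.

(** * Reflections of the index j *)

Section Reindex.
Variables (K : numFieldType) (k : K) (p : nat).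

(** Substituting p = 3 (k + 3) leaves rational identities in k, i and j. *)
Lemma reindex_principal i j : admissible Principal p k -> (i + j <= p)%N ->
  [/\ xi k Third i (p - i - j) = - (xi k Second i j + i%:R - 1),
      chi k Third i (p - i - j) = chi k Second i j,
      xi k Second i (p - i - j) = - (xi k Third i j + i%:R - 1) &
      chi k Second i (p - i - j) = chi k Third i j].
Proof.
move=> hk hij; have k0 := k3_neq0 hk.
have -> : (p - i - j)%N = (p - (i + j))%N by lia.
have pE : p%:R = 3 * (k + 3) by case: hk => _ _ ->; field.
by rewrite /xi /chi natrB // natrD pE; split; field; rewrite // addrC.
Qed.

Lemma reindex_coprincipal i j : admissible Coprincipal p k -> (2 * i + j <= p)%N ->
  xi k Second i (p - 2 * i - j) = - (xi k Second i j + i%:R - 1) /\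
  chi k Second i (p - 2 * i - j) = chi k Second i j.
Proof.
move=> hk hij; have k0 := k3_neq0 hk.
have -> : (p - 2 * i - j)%N = (p - (2 * i + j))%N by lia.
have pE : p%:R = 4 * (k + 3) by case: hk => _ _ ->; field.
by rewrite /xi /chi natrB // natrD natrM pE; split; field; rewrite // addrC.
Qed.

(** The J_0-weights of the top space run from (1 - i) / 2 to (i - 1) / 2, symmetrically about 0. *)
Lemma xi_First i j : - (xi k First i j + i%:R - 1) = xi k First i j.
Proof. by rewrite /xi; field. Qed.

End Reindex.

Theorem proposition8p2 (R : realType) (c : admissible_case) (p : nat)
  (k : complex R)
  (hk : admissible c p k)
  (V : vertexAlgebra (complex R)) (J L Gp Gm : V)
  (hV : is_subregular_W k J L Gp Gm)
  (S : vertexAlgebra (complex R)) (pi : vhom V S)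
  (hS : is_simple_quotient pi)
  (Phi : vhom V V) (Phi_aut : bijective Phi)
  (Phi_L : Phi L = L) (Phi_J : Phi J = - J)
  (Phi_Gp : Phi Gp = Gm) (Phi_Gm : Phi Gm = Gp) :
  [/\ acts_on_classes (twist Phi) (simple_quotient_module pi),
      forall (s : module_form) (i j : nat), index_range c p s i j ->
        forall M : vmodule V,
          is_L J L Gp Gm (xi k s i j) (chi k s i j) M ->
          is_L J L Gp Gm (- (xi k s i j + i%:R - 1)) (chi k s i j)
            (twist Phi M) /\
          forall N : vmodule V,
            is_L J L Gp Gm (- (xi k s i j + i%:R - 1)) (chi k s i j) N ->
            viso (twist Phi M) N,
      (forall a : V, Phi (Phi a) = a) /\
      (forall M : vmodule V, viso (twist Phi (twist Phi M)) M),
      forall M : vmodule V, of_form k J L Gp Gm c p First M ->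
        viso (twist Phi M) M &
      match c with
      | Principal =>
          bijective_on_classes (twist Phi)
            (of_form k J L Gp Gm c p Second) (of_form k J L Gp Gm c p Third)
      | Coprincipal =>
          acts_on_classes (twist Phi) (of_form k J L Gp Gm c p Second)
      end].
Proof.
have hPhiK := PhiK hV Phi_L Phi_J Phi_Gp Phi_Gm.
have hTT := twist_twist hV Phi_L Phi_J Phi_Gp Phi_Gm.
have hL (s : module_form) (i j : nat) (M : vmodule V) : (0 < i)%N ->
    is_L J L Gp Gm (xi k s i j) (chi k s i j) M ->
    is_L J L Gp Gm (- (xi k s i j + i%:R - 1)) (chi k s i j) (twist Phi M).
  case: i => // n _ hM.
  (* Here n = i - 1 is the last power of G^+_0 that does not kill the lowest weight vector. *)
  rewrite (_ : _ + _ - 1 = xi k s n.+1 j + n%:R); last by rewrite -natr1; ring.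
  apply: (twist_is_L hV Phi_aut Phi_L Phi_J Phi_Gp Phi_Gm) hM => [l hl|].
    by rewrite (lower_coef_xi_eq0 hk) eqSS neq_ltn hl.
  by apply/eqP; rewrite (lower_coef_xi_eq0 hk).
split.
- split=> [M|M N _ _]; first exact: (twist_simple_quotient_module hV Phi_aut Phi_L hS).
  exact: viso_pullback.
- move=> s i j [i0 _ _] M hM; have hM' := hL s i j M i0 hM.
  by split=> // N; apply: (is_L_unique hV hM').
- by [].
- move=> M [i [j [[i0 _ _] hM]]].
  by apply: (is_L_unique hV) (hM); rewrite -xi_First; apply: hL.
case: c hk => hk.
- split=> [M [i [j [[i0 j0 [hi hj]] hM]]]|M N _ _|N [i [j [[i0 j0 [hi hj]] hN]]]].
  (* The reflection j |-> p - i - j preserves the range 1 <= j <= p - i - 1. *)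
  + have [e1 e2 _ _] := reindex_principal hk (i := i) (j := j) ltac:(lia).
    exists i, (p - i - j)%N; split; first by split; lia.
    by rewrite e1 e2; apply: hL.
  + by split; [apply: viso_pullback | apply: twist_viso].
  + have [_ _ e1 e2] := reindex_principal hk (i := i) (j := j) ltac:(lia).
    (* The twist is an involution on classes, so twisting [N] gives a preimage. *)
    exists (twist Phi N); split; last exact: hTT.
    exists i, (p - i - j)%N; split; first by split; lia.
    by rewrite e1 e2; apply: hL.
- split=> [M [i [j [[i0 j0 [hi hj]] hM]]]|M N _ _]; last exact: viso_pullback.
  have [e1 e2] := reindex_coprincipal hk (i := i) (j := j) ltac:(lia).
  exists i, (p - 2 * i - j)%N; split; first by split; lia.
  by rewrite e1 e2; apply: hL.
Qed.
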